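(* There exist continuum many pairwise non-isomorphic $5$-generated non-amenable boundedly acyclic groups.
   Context: All groups are discrete. For a group $\Gamma$ and $n\ge 0$, let $C^n_b(\Gamma;\mathbb{R})$ be the space of bounded functions $f\colon\Gamma^{n+1}\to\mathbb{R}$ that are invariant under the diagonal left-translation action of $\Gamma$, with coboundary $(\delta f)(g_0,\dots,g_{n+1})=\sum_{j=0}^{n+1}(-1)^j f(g_0,\dots,\widehat{g_j},\dots,g_{n+1})$. The bounded cohomology $H^n_b(\Gamma;\mathbb{R})$ is the $n$-th cohomology of this complex. A group $\Gamma$ is boundedly acyclic if $H^n_b(\Gamma;\mathbb{R})\cong 0$ for all $n\ge1$. A group is $n$-generated if it admits a generating set with $n$ elements. *)

(* Defs.v *)
From HB Require Import structures.
From mathcomp Require Import all_boot all_order all_algebra.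
From mathcomp Require Import all_classical all_reals all_analysis.
Import Order.TTheory GRing.Theory Num.Theory.
Import numFieldNormedType.Exports.

Set Implicit Arguments.
Unset Strict Implicit.
Unset Printing Implicit Defensive.

Local Open Scope classical_set_scope.
Local Open Scope ring_scope.

Section BoundedCohomology.
Variables (R : realType) (G : groupType).

(* A point of G^(n+1) is a function g : 'I_n.+1 -> G. *)
Definition bounded_cochain (n : nat) : set (('I_n.+1 -> G) -> R) :=
  [set f | bounded_fun f /\
           forall (a : G) (g : 'I_n.+1 -> G), f (fun i => (a * g i)%g) = f g].

(* [g \o lift j] is g with its j-th entry omitted. *)
Definition coboundary (n : nat) (f : ('I_n.+1 -> G) -> R) :
    ('I_n.+2 -> G) -> R :=
  fun g => \sum_(j < n.+2) (-1) ^+ j * f (g \o lift j).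

Lemma bounded_cochain0 n : @bounded_cochain n 0.
Proof. by split=> //; exact: bounded_cst. Qed.

Lemma bounded_cochainB n f h :
  @bounded_cochain n f -> bounded_cochain h -> bounded_cochain (f - h).
Proof.
move=> [bf If] [bh Ih]; split; last by move=> a g; rewrite !fctE If Ih.
exact: bounded_funD bf (bounded_funN bh).
Qed.

Lemma coboundary0 n : @coboundary n 0 = 0.
Proof. by apply/funext => g; rewrite /coboundary big1// => j _; rewrite mulr0. Qed.

Lemma coboundaryB n : {morph @coboundary n : f h / f - h}.
Proof.
move=> f h; apply/funext => g; rewrite !fctE /coboundary -sumrB.
by apply: eq_bigr => j _; rewrite mulrBr.
Qed.

Definition bounded_cocycle (n : nat) : {pred ('I_n.+1 -> G) -> R} :=
  mem [set f | bounded_cochain f /\ coboundary f = 0].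

Fact bounded_cocycle_zmod_closed n : zmod_closed (@bounded_cocycle n).
Proof.
split=> [|f h]; first by rewrite inE; split; [exact: bounded_cochain0|exact: coboundary0].
rewrite !inE => -[bf df] [bh dh]; split; first exact: bounded_cochainB.
by rewrite coboundaryB df dh subrr.
Qed.
HB.instance Definition _ n :=
  GRing.isZmodClosed.Build _ (@bounded_cocycle n) (@bounded_cocycle_zmod_closed n).

Record cocycle (n : nat) := Cocycle {
  cocycle_fun :> ('I_n.+1 -> G) -> R ;
  cocycleP : cocycle_fun \in @bounded_cocycle n }.
HB.instance Definition _ n := [isSub for @cocycle_fun n].
HB.instance Definition _ n := [Choice of @cocycle n by <:].
HB.instance Definition _ n := [SubChoice_isSubZmodule of @cocycle n by <:].

(* In degree 0 the incoming differential is 0 -> C^0. *)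
Definition coboundaries (n : nat) : set (('I_n.+1 -> G) -> R) :=
  match n with
  | 0 => [set 0]
  | m.+1 => @coboundary m @` @bounded_cochain m
  end.

Definition bounded_coboundary (n : nat) : {pred cocycle n} :=
  mem [set z : cocycle n | @coboundaries n z].

Fact bounded_coboundary_zmod_closed n : zmod_closed (@bounded_coboundary n).
Proof.
split=> [|y z]; rewrite !inE.
  case: n => [//|n]; exists 0; [exact: bounded_cochain0 | exact: coboundary0].
case: n y z => [|n] y z /=; first by move=> y0 z0; rewrite y0 z0 subrr.
move=> [f bf <-] [h bh <-]; exists (f - h); first exact: bounded_cochainB.
exact: coboundaryB.
Qed.
HB.instance Definition _ n := GRing.isZmodClosed.Build _
  (@bounded_coboundary n) (@bounded_coboundary_zmod_closed n).

(* The quotient is taken as additive groups, forgetting the scalars. *)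
Definition bounded_cohomology (n : nat) : zmodType :=
  {ideal_quot @bounded_coboundary n}%qT.

Definition boundedly_acyclic : Prop :=
  forall n : nat, (1 <= n)%N -> forall c : bounded_cohomology n, c = 0.

Lemma boundedly_acyclicP :
  boundedly_acyclic <->
  forall (n : nat) (f : ('I_n.+2 -> G) -> R), bounded_cochain f ->
    coboundary f = 0 -> exists2 h, @bounded_cochain n h & coboundary h = f.
Proof.
have pi0 n (z : cocycle n) :
    (\pi_{ideal_quot @bounded_coboundary n} z == 0)%qT = (z \in @bounded_coboundary n).
  by rewrite -[in RHS](subr0 z) Quotient.idealrBE (@pi_zeror _ _ _ _ _ {ideal_quot _}%qT).
split=> [acG n f bf df|acG [//|n] _ c].
  have Zf : f \in @bounded_cocycle n.+1 by rewrite inE.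
  have /eqP := acG n.+1 isT (\pi_{ideal_quot @bounded_coboundary n.+1} (Cocycle Zf))%qT.
  by rewrite pi0 inE /= => -[h bh <-]; exists h.
rewrite -[c]reprK; case: (repr c : cocycle n.+1) => f Zf.
apply/eqP; rewrite pi0 inE /=.
move: (Zf); rewrite inE => -[bf df].
by have [h bh <-] := acG n f bf df; exists h.
Qed.

(* A finitely additive left-invariant probability measure on all subsets. *)
Definition amenable : Prop :=
  exists mu : set G -> R,
    [/\ forall A, 0 <= mu A,
        mu setT = 1,
        forall A B, A `&` B = set0 -> mu (A `|` B) = mu A + mu B &
        forall (a : G) A, mu [set (a * x)%g | x in A] = mu A].

End BoundedCohomology.

Definition generates (G : groupType) (S : set G) : Prop :=
  forall H : groupClosed G, (forall s, S s -> s \in H) -> forall x : G, x \in H.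

Definition n_generated (n : nat) (G : groupType) : Prop :=
  exists S : set G, (S #= `I_n)%card /\ generates S.

Definition isomorphic (G H : groupType) : Prop :=
  exists f : {multiplicative G -> H}, bijective f.

(* Main.v *)
Require Import Defs.
From HB Require Import structures.
From mathcomp Require Import all_boot all_order all_algebra.
From mathcomp Require Import all_classical all_reals all_analysis.
From mathcomp Require Import algC cyclotomic.
From mathcomp Require Import ring lra zify.
Import Order.TTheory GRing.Theory Num.Theory.
Import numFieldNormedType.Exports.

(** The groups are quotients of wreath products with the integers.  For a set
    [A] of primes, [lamplighter R A] is generated by [t], which shifts the
    levels of a space indexed by the integers, and by four bijections [a], [b],
    [u], [v] that move level 0 only.  Conjugates of the last four by different
    powers of [t] have disjoint supports, hence commute.

    Bounded acyclicity follows from these commuting conjugates alone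
    ([acyclic_of_commuting_conjugates]); this is a finitary form of Monod's
    argument on lamplighter groups.  Averaging all the arguments of a bounded
    cocycle over a finite law on the group does not change its class: the prism
    operator is a homotopy ([prism_homotopy]).  A limit of homotopies along an
    ultrafilter then reduces the theorem to finding laws for which the averaged
    cochain becomes constant in the limit ([acyclic_of_smoothing]), since a
    constant cocycle of positive degree is the coboundary of a constant.  The law used is that
    of [t ^- j * x], where [j] is uniform in a long interval and [x] is a product
    of independent random words, one at each site of an even longer interval.

    To compare the averages at [(g_0, .., g_n)] and at [(1, .., 1)], translate
    the tuple diagonally by [t ^+ rho]; as the random shifts [j] are nearly
    invariant, this replaces each [g_i] by finitely many letters inserted at
    sites displaced by [rho].  Now average over widely spaced values of [rho]:
    the insertions happen at independent places and each has bounded density, so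
    the average of their densities has variance tending to 0, and inserting the
    letters changes the law by little in total variation ([mean_square]).
    This is the ergodicity of a Bernoulli shift in quantitative form, and is why
    non-amenable lamps do no harm.

    The homeomorphisms [a] and [b] of the real line lift a ping-pong pair of
    circle maps; an equivariant map from the group to the line carries this
    ping-pong to the group and excludes an invariant mean
    ([lamplighter_nonamenable]).  The bijections permute points of a totally
    ordered set increasingly and multiply a coordinate in [algC] by roots of
    unity.  An increasing bijection has no nontrivial finite orbit, so all
    torsion comes from the roots of unity, and [v] is the only generator that
    contributes any: for a prime [p], there is an element of order [p] exactly
    when [p] is in [A] ([lamplighter_torsion_free], [lamplighter_torsion]).
    Hence [A] is an invariant of the group, and a real number is encoded in a set
    of primes through the rational numbers below it. *)

Set Implicit Arguments.
Unset Strict Implicit.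
Unset Printing Implicit Defensive.

Local Open Scope ring_scope.

(** * Averages over finite types and Banach limits *)

Section Average.
Variable R : realType.
Implicit Types T : finType.

Definition avg T (F : T -> R) : R := (\sum_x F x) / #|T|%:R.

Lemma eq_avg T (F H : T -> R) : F =1 H -> avg F = avg H.
Proof. by move=> FH; rewrite /avg; under eq_bigr do rewrite FH. Qed.

Lemma avgD T (F H : T -> R) : avg (fun x => F x + H x) = avg F + avg H.
Proof. by rewrite /avg big_split mulrDl. Qed.

Lemma avgN T (F : T -> R) : avg (fun x => - F x) = - avg F.
Proof. by rewrite /avg sumrN mulNr. Qed.

Lemma avgB T (F H : T -> R) : avg (fun x => F x - H x) = avg F - avg H.
Proof. by rewrite avgD avgN. Qed.

Lemma avgZ T c (F : T -> R) : avg (fun x => c * F x) = c * avg F.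
Proof. by rewrite /avg -mulr_sumr mulrA. Qed.

Lemma avg_cst T c : (0 < #|T|)%N -> avg (fun _ : T => c) = c.
Proof.
move=> T0; rewrite /avg sumr_const -[_ *+ _]mulr_natr mulfK//.
by rewrite pnatr_eq0 -lt0n.
Qed.

Lemma avg_sum T I (r : seq I) (F : I -> T -> R) :
  avg (fun x => \sum_(i <- r) F i x) = \sum_(i <- r) avg (F i).
Proof. by rewrite /avg exchange_big mulr_suml. Qed.

Lemma ler_avg T (F H : T -> R) : (forall x, F x <= H x) -> avg F <= avg H.
Proof. by move=> FH; rewrite ler_wpM2r ?invr_ge0 ?ler0n// ler_sum. Qed.

Lemma ler_norm_avg T (F : T -> R) : `|avg F| <= avg (fun x => `|F x|).
Proof.
rewrite normrM [`|_^-1|]ger0_norm ?invr_ge0 ?ler0n//.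
by rewrite ler_wpM2r ?invr_ge0 ?ler0n// ler_norm_sum.
Qed.

Lemma avg_bounded T (F : T -> R) B :
  (0 < #|T|)%N -> (forall x, `|F x| <= B) -> `|avg F| <= B.
Proof.
move=> T0 FB; apply: le_trans (ler_norm_avg _) _.
by rewrite -[leRHS](@avg_cst T)// ler_avg.
Qed.

Lemma avg_pair T T' (F : T * T' -> R) :
  avg F = avg (fun x => avg (fun x' => F (x, x'))).
Proof.
rewrite /avg card_prod natrM invfM -mulr_suml pair_bigA /= -mulrA [_^-1 / _]mulrC.
by congr (_ * _); apply: eq_bigr => -[].
Qed.

End Average.

Section BanachLimit.
Variable R : realType.
Local Open Scope classical_set_scope.

(** Evaluation of the limit along an ultrafilter finer than [\oo]; bounded
    sequences converge along it by compactness of segments. *)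
Lemma banach_limit : exists L : (nat -> R) -> R,
  [/\ forall u v (B C : R), (forall n, `|u n| <= B) -> (forall n, `|v n| <= C) ->
        L (fun n => u n + v n) = L u + L v,
      forall u (c B : R), (forall n, `|u n| <= B) -> L (fun n => c * u n) = c * L u,
      forall u (B : R), (forall n, `|u n| <= B) -> `|L u| <= B &
      forall u (c : R), (u @ \oo --> c) -> L u = c].
Proof.
have [U [UU oU]] := ultraFilterLemma (eventually_filter : ProperFilter \oo).
have cvgU (u : nat -> R) B : (forall n, `|u n| <= B) -> cvg (u @ U).
  move=> uB.
  have pU : ProperFilter (u @ U) by exact: fmap_proper_filter.
  have [|l [_ ul]] := @segment_compact R (- B) B (u @ U) pU.
    by apply: (@filterE _ U) => n /=; rewrite in_itv/= -ler_norml.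
  apply/cvg_ex; exists l => V Vl.
  have [//|UV] := in_ultra_setVsetC (u @^-1` V) UU.
  by have [z [nVz Vz]] := ul (~` V) V UV Vl.
exists (fun u => lim (u @ U)); split.
- by move=> u v B C uB vC; apply: (limD (cvgU _ _ uB) (cvgU _ _ vC)).
- by move=> u c B uB; apply/cvg_lim => //; apply: cvgM; [exact: cvg_cst|exact: cvgU uB].
- move=> u B uB; have cu := cvgU _ _ uB; rewrite ler_norml.
  apply/andP; split; [apply: limr_ge => //|apply: limr_le => //];
    by apply: (@filterE _ U) => n; have := uB n; rewrite ler_norml => /andP[].
- by move=> u c uc; apply/cvg_lim => //; apply: cvg_trans uc; exact: cvg_app.
Qed.

End BanachLimit.

(** * Cochains on lists and the prism homotopy *)

Section ListCochains.
Variables (R : realType) (G : groupType).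
Implicit Types (f : seq G -> R) (l : seq G) (x : G).

Definition face_cons x f : seq G -> R := fun l => f (x :: l).

(** Cochains of all degrees are encoded as one function on lists, so that the
    homogeneous coboundary becomes a recursion on the list and the homotopy
    formula an induction. *)
Fixpoint seq_coboundary f l : R :=
  if l is x :: l' then f l' - seq_coboundary (face_cons x f) l' else 0.

Lemma seq_coboundaryE f l : seq_coboundary f l =
  \sum_(j < size l) (-1) ^+ j * f (take j l ++ drop j.+1 l).
Proof.
elim: l f => [|x l IH] f /=; first by rewrite big_ord0.
rewrite big_ord_recl /= expr0 mul1r drop0 IH -sumrN; congr (_ + _).
by apply: eq_bigr => j _; rewrite exprS mulN1r mulNr.
Qed.

Lemma seq_coboundaryB f h l :
  seq_coboundary (fun c => f c - h c) l = seq_coboundary f l - seq_coboundary h l.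
Proof.
rewrite !seq_coboundaryE -sumrB; apply: eq_bigr => j _.
by rewrite mulrBr.
Qed.

Lemma eq_seq_coboundary f h l :
  (forall c, (size c).+1 = size l -> f c = h c) ->
  seq_coboundary f l = seq_coboundary h l.
Proof.
elim: l f h => [//|x l IH] f h fh /=.
by rewrite fh//; congr (_ - _); apply: IH => c cl; apply: fh; rewrite /= cl.
Qed.

Lemma seq_coboundaryK f l : seq_coboundary (seq_coboundary f) l = 0.
Proof.
elim: l f => [//|x l IH] f /=.
have -> : face_cons x (seq_coboundary f) =
  (fun c => f c - seq_coboundary (face_cons x f) c) by [].
by rewrite seq_coboundaryB IH subr0 subrr.
Qed.

Lemma seq_coboundary_avg (T : finType) (F : T -> seq G -> R) l :
  seq_coboundary (fun c => avg (F^~ c)) l = avg (fun w => seq_coboundary (F w) l).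
Proof.
rewrite seq_coboundaryE; under [in RHS]eq_avg do rewrite seq_coboundaryE.
by rewrite avg_sum; apply: eq_bigr => j _; rewrite avgZ.
Qed.

Lemma seq_coboundary_cst c l :
  seq_coboundary (fun _ => c) l = c *+ odd (size l).
Proof.
elim: l => [//|x l] /=; rewrite /face_cons => ->.
by case: odd; rewrite ?subrr ?subr0.
Qed.

Definition law (T : finType) (y : T -> G) (F : G -> R) : R := avg (F \o y).

(** Integration of all the entries of a list, each against its own functional.
    Functionals rather than measures appear so that a left translate, a shifted
    law or a perturbed law can be substituted in one entry. *)
Fixpoint iter_law (es : seq ((G -> R) -> R)) f : R :=
  if es is e :: es' then e (fun z => iter_law es' (face_cons z f)) else f [::].

Section Smoothing.
Variables (T : finType) (y : T -> G).
Hypothesis T_gt0 : (0 < #|T|)%N.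

Definition smooth f l : R :=
  iter_law [seq law (fun w => x * y w)%g | x <- l] f.

(** The prism over the map [x |-> x * y w], with independent samples of [w] at
    the vertices. *)
Fixpoint prism f l : R :=
  if l is x :: l' then
    avg (fun w => f [:: x * y w, x & l']%g - prism (face_cons (x * y w)%g f) l')
  else 0.

Lemma prismB f h l : prism (fun c => f c - h c) l = prism f l - prism h l.
Proof.
elim: l f h => [|x l IH] f h /=; first by rewrite subrr.
rewrite -avgB; apply: eq_avg => w.
by rewrite [X in _ - X](IH (face_cons _ f) (face_cons _ h)); ring.
Qed.

(** Smoothing is homotopic to the identity.  The recursion for [prism] peels off
    the first vertex, and independence of the samples makes the inductive
    hypothesis applicable under the average over that vertex. *)
Lemma prism_homotopy f l :
  prism (seq_coboundary f) l + seq_coboundary (prism f) l = f l - smooth f l.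
Proof.
elim: l f => [|x l IH] f; first by rewrite /= addr0 subrr.
rewrite [smooth f _]/= /law /=.
set z := fun w => (x * y w)%g.
have -> : f (x :: l) - avg ((fun u => iter_law [seq law (fun w => x * y w)%g | x <- l] (face_cons u f)) \o z)
  = avg (fun w => f (x :: l) - face_cons (z w) f l
      + (prism (seq_coboundary (face_cons (z w) f)) l +
         seq_coboundary (prism (face_cons (z w) f)) l)).
  under [RHS]eq_avg do rewrite IH addrA subrK.
  by rewrite avgB avg_cst.
rewrite [X in X + _]/= [X in _ + X]/=.
have -> : seq_coboundary (face_cons x (prism f)) l =
  avg (fun w => seq_coboundary (face_cons x (face_cons (z w) f)) l
                - seq_coboundary (prism (face_cons (z w) f)) l).
  rewrite -[LHS]/(seq_coboundary (fun c => avg (fun w =>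
    face_cons x (face_cons (z w) f) c - prism (face_cons (z w) f) c)) l).
  by rewrite seq_coboundary_avg; apply: eq_avg => w; rewrite seq_coboundaryB.
rewrite -[prism f l](@avg_cst _ T)// -!avgB -avgD; apply: eq_avg => w.
rewrite -/(z w).
have -> : face_cons (z w) (seq_coboundary f) =
  (fun c => f c - seq_coboundary (face_cons (z w) f) c) by [].
by rewrite prismB /face_cons; ring.
Qed.

Lemma prism_bounded f l B : (forall c, `|f c| <= B) -> `|prism f l| <= B *+ size l.
Proof.
elim: l f => [|x l IH] f fB /=; first by rewrite normr0.
apply: avg_bounded => // w; rewrite mulrS (le_trans (ler_normB _ _))//.
by rewrite lerD// IH// => c; apply: fB.
Qed.

Lemma smooth_bounded f l B : (forall c, `|f c| <= B) -> `|smooth f l| <= B.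
Proof.
elim: l f => [|x l IH] f fB; first exact: fB.
by apply: avg_bounded => // w; apply: IH => c; apply: fB.
Qed.

Lemma prism_translate f l a :
  prism f [seq a * z | z <- l]%g = prism (fun c => f [seq a * z | z <- c]%g) l.
Proof.
elim: l f => [//|x l IH] f /=; apply: eq_avg => w.
by rewrite -!mulgA IH; congr (_ - prism _ _); rewrite /face_cons/= mulgA.
Qed.

Lemma eq_prism f h l : f =1 h -> prism f l = prism h l.
Proof. by move=> /funext ->. Qed.

End Smoothing.
End ListCochains.

(** * Acyclicity from smoothing laws *)

Section Criterion.
Local Open Scope classical_set_scope.
Variables (R : realType) (G : groupType).
Implicit Types (f : seq G -> R) (l : seq G) (x : G).

Lemma prism_eq0 (T : finType) (y : T -> G) f l : (0 < #|T|)%N ->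
  (forall c, size c = (size l).+1 -> f c = 0) -> prism y f l = 0.
Proof.
move=> T0; elim: l f => [//|x l IH] f f0 /=.
rewrite -[RHS](@avg_cst _ T)//; apply: eq_avg => w.
by rewrite f0//= IH ?subrr// => c cl; apply: f0; rewrite /= cl.
Qed.

Lemma codom_nth n l : size l = n -> codom (fun i : 'I_n => nth 1%g l i) = l.
Proof.
move=> ln; apply: (@eq_from_nth _ 1%g); rewrite size_codom card_ord// => i lt_i.
by rewrite (nth_map (Ordinal lt_i)) -?cardE ?card_ord// nth_enum_ord.
Qed.

Lemma nth_codom_ord n (g : 'I_n -> G) (i : 'I_n) : nth 1%g (codom g) i = g i.
Proof. by rewrite (nth_map i) ?nth_ord_enum// -cardE card_ord. Qed.

Lemma coboundary_codom n (F : ('I_n.+1 -> G) -> R) f g :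
  (forall u, F u = f (codom u)) -> coboundary F g = seq_coboundary f (codom g).
Proof.
move=> Ff; rewrite seq_coboundaryE size_codom card_ord; apply: eq_bigr => j _.
rewrite Ff; congr (_ * f _); have lt_j := ltn_ord j.
have jn : (j <= size (codom g))%N by rewrite size_codom card_ord ltnW.
have sz : size (take j (codom g) ++ drop j.+1 (codom g)) = n.+1.
  by rewrite size_cat size_takel// size_drop size_codom card_ord; lia.
apply: (@eq_from_nth _ 1%g); rewrite size_codom card_ord// => i lt_i.
have -> : i = Ordinal lt_i by [].
rewrite nth_codom_ord /= -nth_codom_ord nth_cat size_takel//= /bump.
case: (ltnP i j) => ij; first by rewrite nth_take// leqNgt ij.
by rewrite nth_drop; congr nth; lia.
Qed.

Variables (T : nat -> finType) (y : forall k, T k -> G).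
Hypothesis T_gt0 : forall k, (0 < #|T k|)%N.

(** A Banach limit [h] of the prism operators primitivizes a cocycle up to the
    limit [C] of its smoothings, a constant by hypothesis.  In one parity the
    cocycle equation forces [C = 0]; in the other, [C] is the coboundary of the
    constant cochain [C]. *)
Lemma acyclic_of_smoothing :
  (forall f B l, (forall c, `|f c| <= B) ->
     (forall a c, f [seq a * z | z <- c]%g = f c) ->
     (fun k => smooth (@y k) f l - smooth (@y k) f (nseq (size l) 1%g)) @ \oo
       --> (0 : R)) ->
  boundedly_acyclic R G.
Proof.
move=> ergodic; apply/boundedly_acyclicP => n f [bf invf] df0.
have [L [LD LZ LB Llim]] := banach_limit R.
have [B fB] : exists B : R, forall g, `|f g| <= B.
  by case: bf => B [_ /(_ (B + 1))]; rewrite ltrDl => /(_ ltr01) fB;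
    exists (B + 1) => g; apply: fB.
have B0 : 0 <= B by apply: le_trans (fB (fun=> 1%g)).
pose F l : R := if size l == n.+2 then f (fun i => nth 1%g l i) else 0.
have FB c : `|F c| <= B by rewrite /F; case: ifP => // _; rewrite normr0.
have FT a c : F [seq a * z | z <- c]%g = F c.
  rewrite /F size_map; case: eqP => // cn; rewrite -[RHS](invf a); congr f.
  by apply/funext => i; rewrite (nth_map 1%g) // cn.
have fF u : f u = F (codom u).
  rewrite /F size_codom card_ord eqxx; congr f.
  by apply/funext => i; rewrite nth_codom_ord.
have dF0 c : size c = n.+3 -> seq_coboundary F c = 0.
  move=> cn; rewrite -(codom_nth cn) -(coboundary_codom _ fF).
  by rewrite df0.
pose h l : R := L (fun k => prism (@y k) F l).
have LN u (C : R) : (forall k, `|u k| <= C) -> L (fun k => - u k) = - L u.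
  by move=> uC; rewrite -mulN1r -(LZ _ _ _ uC); congr L; apply/funext => k; rewrite mulN1r.
have Ld (H : nat -> seq G -> R) l :
    (forall c, exists C : R, forall k, `|H k c| <= C) ->
  L (fun k => seq_coboundary (H k) l) = seq_coboundary (fun c => L (H^~ c)) l /\
  exists C : R, forall k, `|seq_coboundary (H k) l| <= C.
  elim: l H => [|x l IH] H HB.
    have b0 k : `|seq_coboundary (H k) [::]| <= 0 :> R by rewrite normr0.
    split; last by exists 0.
    by apply/eqP; rewrite -normr_le0; apply: LB b0.
  have [|dE [C' HC']] := IH (fun k => face_cons x (H k)).
    by move=> c; have [C HC] := HB (x :: c); exists C.
  have [C HC] := HB l.
  split; last by exists (C + C') => k /=; rewrite (le_trans (ler_normB _ _)) ?lerD.
  rewrite -[LHS]/(L (fun k => H k l + - seq_coboundary (face_cons x (H k)) l)).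
  rewrite (LD _ _ C C')//; last by move=> k; rewrite normrN.
  by rewrite (LN _ C')// dE.
have PB c : exists C : R, forall k, `|prism (@y k) F c| <= C.
  by exists (B *+ size c) => k; apply: prism_bounded.
(* Any tuple would do as a base point for the limit constant. *)
pose e : seq G := nseq n.+2 1%g.
pose C := L (fun k => smooth (@y k) F e).
have key l : size l = n.+2 -> F l = seq_coboundary h l + C.
  move=> ln; have [<- [D hD]] := Ld (fun k => prism (@y k) F) l PB.
  have sB k l' : `|smooth (@y k) F l'| <= B by apply: smooth_bounded.
  have -> : C = L (fun k => smooth (@y k) F l).
    apply/eqP; rewrite -subr_eq0 /C -(LN _ B) => [|k]; last exact: sB.
    rewrite -(LD _ _ B B)=> [|k|k]; [|exact: sB|by rewrite normrN sB].
    apply/eqP; apply: Llim; rewrite -oppr0.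
    under eq_fun do rewrite -opprB.
    apply: cvgN; have := ergodic F B l FB FT; rewrite ln; exact.
  rewrite -(LD _ _ D B)//.
  apply/esym/Llim; under eq_fun => k.
    have := prism_homotopy (@y k) (T_gt0 k) F l.
    rewrite prism_eq0// => [|c cl]; last by rewrite dF0// cl ln.
    rewrite add0r => ->; rewrite subrK; over.
  exact: cvg_cst.
(* Both the cocycle and the coboundary of h are cocycles, so their difference C is. *)
have Codd : C *+ odd n.+3 = 0.
  pose e' : seq G := nseq n.+3 1%g.
  have e'n : size e' = n.+3 by rewrite size_nseq.
  have := seq_coboundary_cst C e'; rewrite e'n => <-.
  rewrite (@eq_seq_coboundary _ _ _ (fun c => F c - seq_coboundary h c)).
    by rewrite seq_coboundaryB dF0// seq_coboundaryK subrr.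
  by rewrite e'n => c [cn]; rewrite key// addrC addKr.
have Cn : C *+ odd n = C.
  by move: Codd; rewrite /= negbK; case: (odd n) => //= ->.
exists (fun g => h (codom g) + C *+ odd n).
  split.
    exists (B *+ n.+1 + `|C|); split; first exact: num_real.
    move=> M ltM g _ /=; apply: le_trans (ltW ltM).
    rewrite (le_trans (ler_normD _ _))// lerD//.
      apply: LB => k; have := prism_bounded (@y k) (T_gt0 k) (codom g) FB.
      by rewrite size_codom card_ord.
    by rewrite Cn.
  move=> a g; congr (_ + _); rewrite /h; congr L; apply/funext => k.
  have -> : codom (fun i => a * g i)%g = [seq a * z | z <- codom g]%g.
    exact: (map_comp (fun z => a * z)%g g (enum 'I_n.+1)).
  by rewrite prism_translate; apply: eq_prism.
apply/funext => g.
rewrite (@coboundary_codom n _ (fun c => h c - - C)) => [|u]; last by rewrite opprK Cn.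
have gn : size (codom g) = n.+2 by rewrite size_codom card_ord.
rewrite fF key// seq_coboundaryB seq_coboundary_cst gn /= negbK mulNrn Cn.
by rewrite opprK.
Qed.

End Criterion.

(** * Mean-square convergence for independent maps of bounded density *)

Section Spread.
Implicit Types W : finType.

(** Under the uniform law, this bounds by [C] the density of the image law. *)
Definition thin W (C : nat) (phi : W -> W) : Prop :=
  forall w, (#|[pred a | phi a == w]| <= C)%N.

(** The canonical map from [W] to the fibre product of [phi] and [psi] is onto.
    Counting gives that the densities of the two image laws have correlation at
    most 1, which is all that is needed of independence. *)
Definition amalgam W (phi psi : W -> W) : Prop :=
  forall a b, phi a = psi b -> exists c, a = psi c /\ b = phi c.

Lemma thin_id W : @thin W 1 id.
Proof. by move=> w; rewrite (eq_card (B := pred1 w)) ?card1. Qed.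

Lemma thin_comp W C C' (phi psi : W -> W) :
  thin C phi -> thin C' psi -> thin (C * C') (phi \o psi).
Proof.
move=> tphi tpsi w; rewrite -sum1_card.
rewrite (partition_big psi (fun v => phi v == w))//=.
apply: (@leq_trans (\sum_(v | phi v == w) C')); last first.
  by rewrite sum_nat_const leq_mul2r; apply/orP; right; apply: tphi.
apply: leq_sum => v _; apply: leq_trans (tpsi v); rewrite sum1_card.
by apply: subset_leq_card; apply/fintype.subsetP => a; rewrite !inE => /andP[].
Qed.

Lemma amalgamC W (phi psi : W -> W) : amalgam phi psi -> amalgam psi phi.
Proof. by move=> H a b /esym /H[c [-> ->]]; exists c. Qed.

Lemma amalgam_idr W (phi : W -> W) : amalgam phi id.
Proof. by move=> a b <-; exists a. Qed.

(** Fibre squares can be pasted. *)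
Lemma amalgam_comp W (phi phi' psi : W -> W) :
  amalgam phi psi -> amalgam phi' psi -> amalgam (phi \o phi') psi.
Proof. by move=> H H' a b /= /H[c [/H'[d [-> ->]] ->]]; exists d. Qed.

Definition pair_map W W' (phi : W -> W) (psi : W' -> W') (w : W * W') :=
  (phi w.1, psi w.2).

Lemma thin_pair W W' C C' (phi : W -> W) (psi : W' -> W') :
  thin C phi -> thin C' psi -> thin (C * C') (pair_map phi psi).
Proof.
move=> tphi tpsi [w w']; apply: leq_trans (leq_mul (tphi w) (tpsi w')).
rewrite -cardX; apply: subset_leq_card; apply/fintype.subsetP => -[a a'].
by rewrite !inE /pair_map /= xpair_eqE.
Qed.

Lemma amalgam_pair W W' (phi phi' : W -> W) (psi psi' : W' -> W') :
  amalgam phi phi' -> amalgam psi psi' ->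
  amalgam (pair_map phi psi) (pair_map phi' psi').
Proof.
move=> H H' [a a'] [b b'] [/H[c [-> ->]] /H'[c' [-> ->]]].
by exists (c, c').
Qed.

Variable R : realType.

Lemma avg_fibers W (phi : W -> W) (F : W -> R) :
  avg (F \o phi) = avg (fun w => #|[pred a | phi a == w]|%:R * F w).
Proof.
rewrite /avg; congr (_ / _); rewrite (partition_big phi xpredT)//=.
apply: eq_bigr => w _; rewrite -sum1_card natr_sum mulr_suml.
by apply: eq_big => [//|a /eqP ->]; rewrite mul1r.
Qed.

Lemma avg_swap W W' (F : W -> W' -> R) :
  avg (fun x => avg (F x)) = avg (fun x' => avg (F^~ x')).
Proof.
rewrite /avg -!mulr_suml exchange_big /= -!mulrA; congr (_ * _); exact: mulrC.
Qed.

(** The mean over [r] of the densities of the maps [phi r] has mean 1 and, by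
    the two counting conditions, second moment at most [1 + C / #|I|].  The bound
    on the first absolute moment uses [|u| <= eta + u ^+ 2 / eta], which avoids
    square roots. *)
Lemma mean_square (I W : finType) (C : nat) (phi : I -> W -> W) (F : W -> R) B eta :
  (0 < #|I|)%N -> (0 < #|W|)%N -> 0 < eta ->
  (forall r, thin C (phi r)) ->
  (forall r s, r != s -> amalgam (phi r) (phi s)) ->
  (forall w, `|F w| <= B) ->
  `|avg (fun r => avg (F \o phi r)) - avg F| <= B * (eta + C%:R / (eta * #|I|%:R)).
Proof.
move=> I0 W0 eta0 tphi aphi FB.
pose D r w : R := #|[pred a | phi r a == w]|%:R.
pose S w := avg (D^~ w).
have -> : avg (fun r => avg (F \o phi r)) = avg (fun w => S w * F w).
  under eq_avg do rewrite avg_fibers.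
  rewrite avg_swap; apply: eq_avg => w.
  by rewrite mulrC -avgZ; apply: eq_avg => r; rewrite mulrC.
have avgD1 r : avg (D r) = 1.
  rewrite -[RHS](@avg_cst R W)// -[RHS]/(avg ((fun=> 1) \o phi r)) avg_fibers.
  by apply: eq_avg => w; rewrite mulr1.
have avgDD r s : avg (fun w => D r w * D s w) <= 1 + C%:R * (r == s)%:R.
  rewrite -avg_fibers; case: eqVneq => [<-|rs].
    rewrite mulr1 -[leRHS](@avg_cst R W)//; apply: ler_avg => w /=.
    by rewrite -[leLHS]add0r lerD// ler_nat; apply: tphi.
  rewrite mulr0 addr0 /avg ler_pdivrMr ?ltr0n// mul1r -natr_sum ler_nat.
  have -> : (\sum_x #|[pred a | phi s a == phi r x]| =
      #|[pred p : W * W | phi s p.2 == phi r p.1]|)%N.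
    rewrite -sum1_card; under eq_bigr do rewrite -sum1_card.
    by rewrite pair_big_dep.
  (* By amalgamation h maps onto the fibre product. *)
  pose h c := (phi s c, phi r c).
  have sub : [pred p : W * W | phi s p.2 == phi r p.1] \subset codom h.
    apply/fintype.subsetP => -[a b]; rewrite inE /= => /eqP/esym/(aphi r s rs)[c [-> ->]].
    exact: (codom_f h c).
  apply: (leq_trans (subset_leq_card sub)).
  by rewrite (leq_trans (card_size _))// size_codom.
have B0 : 0 <= B by case/card_gt0P: W0 => w _; apply: le_trans (FB w).
rewrite -avgB; apply: le_trans (ler_norm_avg _) _.
apply: (@le_trans _ _ (avg (fun w => B * (eta + (S w - 1) ^+ 2 / eta)))).
  apply: ler_avg => w; rewrite -{2}[F w]mul1r -mulrBl normrM mulrC.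
  apply: ler_pM => //; rewrite -lerBlDl ler_pdivlMr// -real_normK ?num_real//.
  by have := normr_ge0 (S w - 1); nra.
rewrite avgZ; apply: ler_wpM2l => //.
rewrite avgD avg_cst// lerD2l invfM [eta^-1 * _]mulrC mulrA.
under eq_avg do rewrite mulrC.
rewrite avgZ mulrC; apply: ler_wpM2r; first by rewrite invr_ge0 ltW.
have -> : avg (fun w => (S w - 1) ^+ 2) = avg (fun w => S w * S w) - 1.
  have avgS : avg S = 1.
    by rewrite /S avg_swap -[RHS](@avg_cst R I)//; apply: eq_avg.
  have -> : avg (fun w => (S w - 1) ^+ 2) = avg (fun w => S w * S w - (2 * S w - 1)).
    by apply: eq_avg => w; ring.
  by rewrite !avgB avgZ avgS avg_cst//; ring.
have -> : avg (fun w => S w * S w) =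
    avg (fun r => avg (fun s => avg (fun w => D r w * D s w))).
  under [RHS]eq_avg do rewrite avg_swap.
  rewrite avg_swap; apply: eq_avg => w.
  under [RHS]eq_avg do rewrite avgZ mulrC.
  by rewrite avgZ.
rewrite lerBlDl.
apply: (@le_trans _ _ (avg (fun r : I => avg (fun s : I => 1 + C%:R * (r == s)%:R)))).
  by apply: ler_avg => r; apply: ler_avg => s.
apply: (@le_trans _ _ (avg (fun r : I => 1 + C%:R / #|I|%:R))); last by rewrite avg_cst.
apply: ler_avg => r; rewrite avgD avg_cst// avgZ lerD2l ler_wpM2l//.
rewrite /avg (bigD1 r)//= eqxx big1 ?addr0 ?mul1r// => s sr.
by rewrite eq_sym (negbTE sr).
Qed.

End Spread.

(** * Powers of a law *)

Section Powers.
Variables (R : realType) (G : groupType).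

Fixpoint power (T : finType) (n : nat) : finType :=
  if n is m.+1 then (T * power T m)%type else unit.

Fixpoint power_seq (T : finType) (X : Type) (y : T -> X) n : power T n -> seq X :=
  if n is m.+1 return power T n -> seq X then
    fun w => y w.1 :: power_seq y w.2
  else fun=> [::].

Fixpoint power_map (T : finType) (D : Type) (act : D -> T -> T) (ds : seq D) :
    power T (size ds) -> power T (size ds) :=
  if ds is d :: ds' return power T (size ds) -> power T (size ds) then
    pair_map (act d) (@power_map T D act ds')
  else id.
Arguments power_map {T D} act ds w.

Lemma power_gt0 (T : finType) n : (0 < #|T|)%N -> (0 < #|power T n|)%N.
Proof. by move=> T0; elim: n => [|n IH] /=; rewrite ?card_unit// card_prod muln_gt0 T0. Qed.

Lemma iter_law_power (T : finType) (D : Type) (y : T -> G) (act : D -> T -> T)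
    (ds : seq D) (f : seq G -> R) :
  iter_law [seq law (y \o act d) | d <- ds] f =
  avg ((fun w => f (power_seq y w)) \o power_map act ds).
Proof.
elim: ds f => [|d ds IH] f /=; first by rewrite [RHS]avg_cst// card_unit.
rewrite avg_pair; apply: eq_avg => x /=.
by rewrite IH; apply: eq_avg.
Qed.

Lemma power_map_id (T : finType) (D : Type) (ds : seq D) : @power_map T D (fun=> id) ds =1 id.
Proof. by elim: ds => [|d ds IH] // [x w] /=; rewrite /pair_map /= IH. Qed.

Lemma thin_power (T : finType) (D : Type) (act : D -> T -> T) (C : D -> nat) ds :
  (forall d, thin (C d) (act d)) ->
  thin (\prod_(d <- ds) C d)%N (power_map act ds).
Proof.
move=> tact; elim: ds => [|d ds IH] /=; rewrite ?big_nil ?big_cons; first exact: thin_id.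
exact: thin_pair.
Qed.

Lemma amalgam_power (T : finType) (D : eqType) (act act' : D -> T -> T) (ds : seq D) :
  (forall d, d \in ds -> amalgam (act d) (act' d)) ->
  amalgam (power_map act ds) (power_map act' ds).
Proof.
elim: ds => [|d ds IH] H /=; first exact: amalgam_idr.
apply: amalgam_pair; first by apply: H; rewrite mem_head.
by apply: IH => e eds; apply: H; rewrite in_cons eds orbT.
Qed.

(** Independent entries form a single sample of a power of the law, and densities
    and amalgamation pass to products: this is [mean_square] on that power. *)
Lemma mixing (I T : finType) (D : eqType) (y : T -> G) (act : I -> D -> T -> T)
    (C : D -> nat) (ds : seq D) (f : seq G -> R) B eta :
  (0 < #|I|)%N -> (0 < #|T|)%N -> 0 < eta ->
  (forall r d, thin (C d) (act r d)) ->
  (forall r s d, r != s -> d \in ds -> amalgam (act r d) (act s d)) ->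
  (forall c, `|f c| <= B) ->
  `|avg (fun r => iter_law [seq law (y \o act r d) | d <- ds] f) -
    iter_law [seq law y | d <- ds] f| <=
  B * (eta + (\prod_(d <- ds) C d)%N%:R / (eta * #|I|%:R)).
Proof.
move=> I0 T0 eta0 tact aact fB.
have -> : iter_law [seq law y | d <- ds] f =
    avg (fun w : power T (size ds) => f (power_seq y w)).
  rewrite -[LHS]/(iter_law [seq law (y \o (fun=> id) d) | d <- ds] f) iter_law_power.
  by apply: eq_avg => w /=; rewrite power_map_id.
under eq_avg do rewrite iter_law_power.
apply: mean_square => //; first exact: power_gt0.
- by move=> r; apply: thin_power.
- by move=> r s rs; apply: amalgam_power => d dds; apply: aact.
Qed.

Lemma iter_law_bounded (D : eqType) (e : D -> (G -> R) -> R) (ds : seq D)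
    (f : seq G -> R) B :
  (forall d F M, d \in ds -> (forall z, `|F z| <= M) -> `|e d F| <= M) ->
  (forall c, `|f c| <= B) -> `|iter_law [seq e d | d <- ds] f| <= B.
Proof.
elim: ds f => [|d ds IH] f eM fB /=; first exact: fB.
apply: (eM); rewrite ?mem_head// => z.
apply: IH => [d' F M d'ds|c]; last exact: fB.
by apply: eM; rewrite in_cons d'ds orbT.
Qed.

(** Distances in total variation add up over the entries. *)
Lemma iter_law_lip (D : eqType) (e e' : D -> (G -> R) -> R) (delta : D -> R) (ds : seq D)
    (f : seq G -> R) B :
  (forall d F H, d \in ds -> e d (fun z => F z - H z) = e d F - e d H) ->
  (forall d F M, d \in ds -> (forall z, `|F z| <= M) -> `|e d F| <= M) ->
  (forall d F M, d \in ds -> (forall z, `|F z| <= M) -> `|e' d F| <= M) ->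
  (forall d F M, d \in ds -> (forall z, `|F z| <= M) ->
     `|e d F - e' d F| <= delta d * M) ->
  (forall c, `|f c| <= B) ->
  `|iter_law [seq e d | d <- ds] f - iter_law [seq e' d | d <- ds] f| <=
    (\sum_(d <- ds) delta d) * B.
Proof.
move=> eB e1 e'1 ee'; elim: ds f eB e1 e'1 ee' => [|d ds IH] f eB e1 e'1 ee' fB.
  by rewrite big_nil mul0r subrr normr0.
rewrite big_cons mulrDl /=.
have ds1 d' : d' \in ds -> d' \in d :: ds by rewrite in_cons orbC => ->.
pose F z := iter_law [seq e d | d <- ds] (face_cons z f).
pose F' z := iter_law [seq e' d | d <- ds] (face_cons z f).
have F'B z : `|F' z| <= B.
  by apply: iter_law_bounded => [d' H M /ds1|c]; [exact: e'1|exact: fB].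
rewrite -/F -/F' [leRHS]addrC.
have -> : e d F - e' d F' = (e d F - e d F') + (e d F' - e' d F').
  by rewrite addrA subrK.
rewrite (le_trans (ler_normD _ _))// lerD//; last first.
  by apply: ee'; rewrite ?mem_head.
rewrite -eB ?mem_head//; apply: (e1); rewrite ?mem_head// => z.
by apply: IH => [d' F0 H0 /ds1|d' F0 M /ds1|d' F0 M /ds1|d' F0 M /ds1|c];
  [exact: eB|exact: e1|exact: e'1|exact: ee'|exact: fB].
Qed.

End Powers.

(** * Random words on a row of sites *)

Section Sites.
Variable J : finType.

(** A word of length below [L.+1], stored as a length and a tuple whose
    letters beyond that length are ignored.  All lengths have the same
    probability: inserting a letter in front is then a map of the whole type to
    itself, with fibres of size [#|J|], that is wrong only at maximal length. *)
Definition site (L : nat) : finType := ('I_L.+1 * L.+1.-tuple J)%type.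

(** The first component is the random shift, the second one the words. *)
Definition config (L K W : nat) : finType := ('I_K.+1 * {ffun 'I_W -> site L})%type.

(** The length is incremented cyclically and the last letter is dropped, so
    that insertion is total. *)
Definition site_ins L (a : J) (w : site L) : site L := (ordS w.1, [tuple of belast a w.2]).

(** The address [q + w.1] compensates the random shift: letters are inserted
    on the left of [t ^- j * x], that is, before the shift acts. *)
Definition ins_at L K W (q : nat) (a : J) (w : config L K W) : config L K W :=
  (w.1, [ffun p : 'I_W => if val p == (q + w.1)%N then site_ins a (w.2 p) else w.2 p]).

Definition ins_word L K W (rho : nat) (n : seq (nat * J)) : config L K W -> config L K W :=
  foldr (fun pa phi => ins_at (pa.1 + rho) pa.2 \o phi) id n.

Lemma site_gt0 L : (0 < #|J|)%N -> (0 < #|site L|)%N.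
Proof. by move=> J0; rewrite card_prod card_ord muln_gt0 card_tuple expn_gt0 J0. Qed.

Lemma config_gt0 L K W : (0 < #|J|)%N -> (0 < #|config L K W|)%N.
Proof.
move=> J0; rewrite [#|_|]card_prod [X in (X * _)%N]card_ord muln_gt0 /=.
by rewrite [#|_|]card_ffun expn_gt0 site_gt0.
Qed.

(** The only information lost by an insertion is the dropped letter. *)
Lemma thin_site_ins L a : @thin (site L) #|J| (site_ins a).
Proof.
move=> [l u].
have inj : {in [pred w : site L | site_ins a w == (l, u)] &,
    injective (fun w : site L => last a w.2)}.
  move=> [l1 u1] [l2 u2]; rewrite !inE => /eqP <- /eqP e12 /= e.
  have -> : l1 = l2 by apply/ordS_inj; exact/esym/(congr1 fst e12).
  have eb : belast a u1 = belast a u2 by exact/esym/(congr1 (fun w : site L => val w.2) e12).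
  congr (_, _); apply: val_inj.
  by have : a :: u1 = a :: u2; [rewrite !lastI e eb|case].
by rewrite -[leqLHS](card_in_image inj) max_card.
Qed.

Lemma thin_ins_at L K W q a : @thin (config L K W) #|J| (ins_at q a).
Proof.
move=> [j0 x0]; case: (ltnP (q + j0) W) => [lt_q|ge_q].
  pose p0 := Ordinal lt_q.
  have inj : {in [pred w : config L K W | ins_at q a w == (j0, x0)] &,
      injective (fun w : config L K W => w.2 p0)}.
    move=> [j1 x1] [j2 x2]; rewrite !inE => /eqP e1 /eqP e2 /= e.
    have ej1 : j1 = j0 := congr1 fst e1; have ej2 : j2 = j0 := congr1 fst e2.
    rewrite ej1 ej2 in e1 e2 *.
    congr (_, _); apply/ffunP => p; case: (eqVneq p p0) => [->//|pp0].
    have pq : (val p == q + j0)%N = false by apply: contra_neqF pp0 => /eqP pq; apply: val_inj.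
    have /ffunP/(_ p) := congr1 snd (etrans e1 (esym e2)).
    by rewrite !ffunE /= pq.
  have sub : {subset [seq w.2 p0 | w : config L K W in [pred w | ins_at q a w == (j0, x0)]]
      <= [pred w : site L | site_ins a w == x0 p0]}.
    move=> _ /fintype.imageP[[j x] /eqP e ->]; rewrite inE.
    have ej : j = j0 := congr1 fst e.
    by have /ffunP/(_ p0) <- := congr1 snd e; rewrite ffunE /= ej eqxx.
  rewrite -(card_in_image inj); apply: leq_trans (thin_site_ins a (x0 p0)).
  by apply: subset_leq_card; apply/fintype.subsetP.
have J0 : (0 < #|J|)%N by apply/card_gt0P; exists a.
apply: (@leq_trans 1) => //; rewrite -(card1 (j0, x0)).
apply/subset_leq_card/fintype.subsetP => -[j x]; rewrite !inE => /eqP e.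
have ej : j = j0 := congr1 fst e.
apply/eqP; rewrite -e ej; congr (_, _); apply/ffunP => p; rewrite ffunE /=.
by case: eqP => // pq; have := ltn_ord p; rewrite [nat_of_ord p]pq ltnNge ge_q.
Qed.

Lemma thin_ins_word L K W rho n : @thin (config L K W) (#|J| ^ size n) (ins_word rho n).
Proof.
elim: n => [|pa n IH]; first exact: thin_id.
by rewrite /= expnS; apply: thin_comp => //; exact: thin_ins_at.
Qed.

(** Changes made at two different sites can be undone separately. *)
Lemma amalgam_ins_at L K W q q' a a' : q != q' ->
  @amalgam (config L K W) (ins_at q a) (ins_at q' a').
Proof.
move=> qq' [j x] [j' x'] [/= <- /ffunP e].
exists (j, [ffun p : 'I_W => if val p == (q' + j)%N then x' p else x p]).
(* The common preimage takes the site addressed by q' from x', all others from x. *)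
have qj : (q + j == q' + j)%N = false by rewrite eqn_add2r; apply/negbTE.
split; congr (_, _); apply/ffunP => p; have := e p; rewrite !ffunE /=.
  case: (eqVneq (val p) (q' + j)%N) => [->|_ //].
  by rewrite eq_sym qj.
case: (eqVneq (val p) (q' + j)%N) => [->|_].
  by rewrite eq_sym qj.
by case: ifP.
Qed.

Lemma amalgam_ins_word L K W rho rho' n n' :
  (forall pa pb, pa \in n -> pb \in n' -> pa.1 + rho != pb.1 + rho')%N ->
  @amalgam (config L K W) (ins_word rho n) (ins_word rho' n').
Proof.
elim: n => [|pa n IH] H; first exact/amalgamC/amalgam_idr.
apply: amalgam_comp; last first.
  by apply: IH => pb pc pbn; apply: H; rewrite in_cons pbn orbT.
have {IH H} : forall pb, pb \in n' -> (pa.1 + rho != pb.1 + rho')%N.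
  by move=> pb; apply: H; rewrite mem_head.
elim: n' => [|pb n' IH] H; first exact: amalgam_idr.
apply/amalgamC/amalgam_comp; apply/amalgamC.
  by apply: amalgam_ins_at; apply: H; rewrite mem_head.
by apply: IH => pc pcn; apply: H; rewrite in_cons pcn orbT.
Qed.

Definition level L (w : site L) : nat := w.1.

Lemma level_ins_word L K W rho n (w : config L K W) p :
  (level ((ins_word rho n w).2 p) <= level (w.2 p) + size n)%N.
Proof.
elim: n => [|pa n IH] /=; first by rewrite addn0.
rewrite ffunE; case: ifP => _; last by rewrite (leq_trans IH)// leq_add2l.
by rewrite addnS; apply: leq_trans (leq_mod _ _) _.
Qed.

Lemma ins_word1 L K W rho n (w : config L K W) : (ins_word rho n w).1 = w.1.
Proof. by elim: n => [|pa n IH]. Qed.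

Variable R : realType.

Lemma avg_ffun_coord (I S : finType) (i : I) (F : S -> R) : (0 < #|S|)%N ->
  avg (fun x : {ffun I -> S} => F (x i)) = avg F.
Proof.
move=> S0.
(* A product of one-variable functions whose factors other than the i-th are 1. *)
pose H k u : R := if k == i then F u else 1.
rewrite /avg (eq_bigr (fun x : {ffun I -> S} => \prod_k H k (x k))); last first.
  move=> x _; rewrite (bigD1 i)//= {1}/H eqxx big1 ?mulr1// => k ki.
  by rewrite /H (negbTE ki).
rewrite -bigA_distr_bigA/= (bigD1 i)//=.
have -> : \sum_j H i j = \sum_u F u by apply: eq_bigr => u _; rewrite /H eqxx.
rewrite card_ffun.
have -> : \prod_(k | k != i) \sum_j H k j = #|S|%:R ^+ #|I|.-1 :> R.
  rewrite (eq_bigr (fun=> #|S|%:R)) => [|k ki].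
    by rewrite prodr_const; congr (_ ^+ _); rewrite -(cardC1 i).
  by rewrite /H (negbTE ki) sumr_const.
have I0 : (0 < #|I|)%N by apply/card_gt0P; exists i.
rewrite natrX -{2}(prednK I0) exprS invfM mulrACA divff ?mulr1// expf_neq0//.
by rewrite pnatr_eq0 -lt0n.
Qed.

(** The length of a word is uniform. *)
Lemma avg_level L m : (0 < #|J|)%N ->
  avg (fun w : site L => (L < level w + m)%N%:R) <= m%:R / L.+1%:R :> R.
Proof.
move=> J0; rewrite avg_pair.
under eq_avg do rewrite avg_cst ?card_tuple ?expn_gt0 ?J0//.
rewrite /avg card_ord; apply: ler_wpM2r; first by rewrite invr_ge0.
rewrite -natr_sum ler_nat /level /=.
have -> : (\sum_(i < L.+1) (L < i + m) = \sum_(i < L.+1) (rev_ord i < m))%N.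
  apply: eq_bigr => i _; congr nat_of_bool.
  by have := ltn_ord i; rewrite /=; lia.
rewrite (reindex_inj rev_ord_inj); under eq_bigr do rewrite rev_ordK.
rewrite -(big_mkord xpredT (fun i => nat_of_bool (i < m)%N)).
suff -> : (\sum_(0 <= i < L.+1) (i < m) = minn L.+1 m)%N by rewrite geq_minr.
elim: L.+1 => [|k IH]; first by rewrite big_geq// min0n.
by rewrite big_nat_recr//= IH; case: (ltnP k m); lia.
Qed.

End Sites.

(** * Evaluating random words in a group with commuting conjugates *)

Section CommutingConjugates.
Variables (G : groupType) (J : finType) (t : G) (s : J -> G).
Hypothesis comm : forall k i j, (0 < k)%N -> commute (t ^+ k * s i * t ^- k)%g (s j).

Definition lamp (p : nat) (g : G) : G := (t ^+ p * g * t ^- p)%g.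

Lemma lampM p g h : lamp p (g * h)%g = (lamp p g * lamp p h)%g.
Proof. by rewrite /lamp !mulgA mulgVK. Qed.

Lemma lamp1 p : lamp p 1%g = 1%g.
Proof. by rewrite /lamp mulg1 mulgV. Qed.

Lemma lampD p q g : lamp (p + q) g = lamp p (lamp q g).
Proof. by rewrite /lamp expgnDr invgM !mulgA. Qed.

(** The hypothesis concerns conjugates of one factor by positive powers; the
    general case follows on conjugating both factors. *)
Lemma lamp_commute p q i j : p != q -> commute (lamp p (s i)) (lamp q (s j)).
Proof.
wlog pq : p q i j / (p < q)%N.
  move=> H; case: (ltngtP p q) => // pq _; [|apply: commute_sym].
    by apply: (H _ _ i j pq); rewrite neq_ltn pq.
  by apply: (H _ _ j i pq); rewrite neq_ltn pq.
move=> _; rewrite -(subnKC (ltnW pq)) lampD.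
have c : commute (lamp (q - p) (s j)) (s i) by apply: comm; rewrite subn_gt0.
by rewrite /commute -!lampM; congr lamp; exact/esym/c.
Qed.

Definition site_eval L (w : site J L) : G := (\prod_(a <- take w.1 w.2) s a)%g.

Definition lamps_eval L W (x : {ffun 'I_W -> site J L}) : G :=
  (\prod_(p < W) lamp p (site_eval (x p)))%g.

Definition config_eval L K W (w : config J L K W) : G :=
  (t ^- w.1 * lamps_eval w.2)%g.

Definition word_eval (n : seq (nat * J)) : G := (\prod_(pa <- n) lamp pa.1 (s pa.2))%g.

Lemma site_eval_ins L a (w : site J L) : (level w < L)%N ->
  site_eval (site_ins a w) = (s a * site_eval w)%g.
Proof.
case: w => l u; rewrite /level /site_eval /= => lL.
rewrite modn_small//.
suff -> : take l.+1 (belast a u) = a :: take l u by rewrite big_cons.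
have -> : a :: take l u = take l.+1 (a :: u) by [].
rewrite [a :: (u : seq J)]lastI -cats1 takel_cat// size_belast size_tuple ltnS.
exact: ltnW.
Qed.

Lemma commute_site_eval p q i L (w : site J L) : p != q ->
  commute (lamp p (s i)) (lamp q (site_eval w)).
Proof.
move=> pq; rewrite /site_eval; elim: (take _ _) => [|a r IH].
  by rewrite big_nil lamp1; apply: commute1.
by rewrite big_cons lampM; apply: commuteM => //; apply: lamp_commute.
Qed.

Lemma prod_modify (I : eqType) (r : seq I) (q : I) (z : G) (f : I -> G) :
  uniq r -> q \in r -> (forall p, p != q -> commute z (f p)) ->
  (\prod_(p <- r) (if p == q then z * f p else f p) = z * \prod_(p <- r) f p)%g.
Proof.
move=> + + zf; elim: r => [//|p r IH] /= /andP[pr ur]; rewrite in_cons !big_cons.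
case: (eqVneq p q) => [pq _|pq]; last first.
  move=> /= qr.
  by rewrite IH// !mulgA; congr (_ * _)%g; apply/esym/zf.
  rewrite -mulgA; congr (_ * (_ * _))%g; apply: eq_big_seq => p' p'r.
  by case: eqVneq => // e; move: pr; rewrite pq -e p'r.
Qed.

Lemma config_eval_ins_at L K W q a (w : config J L K W) (lt_q : (q + w.1 < W)%N) :
  (level (w.2 (Ordinal lt_q)) < L)%N ->
  config_eval (ins_at q a w) = (lamp q (s a) * config_eval w)%g.
Proof.
case: w lt_q => j x /= lt_q lev; rewrite /config_eval /=.
have -> : lamps_eval [ffun p : 'I_W => if val p == (q + j)%N then site_ins a (x p) else x p]
    = (lamp (q + j) (s a) * lamps_eval x)%g.
  rewrite /lamps_eval -(@prod_modify _ _ (Ordinal lt_q)) ?index_enum_uniq ?mem_index_enum//.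
    apply: eq_bigr => p _; rewrite ffunE -val_eqE /=; case: eqP => // pq.
    have -> : p = Ordinal lt_q by apply: val_inj.
    by rewrite site_eval_ins// lampM.
  by move=> p pq; apply: commute_site_eval; rewrite eq_sym.
by rewrite /lamp addnC expgnDr invgM !mulgA mulVg mul1g -!mulgA.
Qed.

(** Insertion of letters is left translation, except when a word overflows; the
    level condition excludes this. *)
Lemma config_eval_ins_word L K W rho n (w : config J L K W) :
  (forall pa (lt_q : (pa.1 + rho + w.1 < W)%N), pa \in n ->
     level (w.2 (Ordinal lt_q)) + size n <= L)%N ->
  (forall pa, pa \in n -> pa.1 + rho + w.1 < W)%N ->
  config_eval (ins_word rho n w) = (lamp rho (word_eval n) * config_eval w)%g.
Proof.
elim: n => [|pa n IH] lev ltW /=.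
  by rewrite /word_eval big_nil lamp1 mul1g.
have lt_q : (pa.1 + rho + w.1 < W)%N by apply: ltW; rewrite mem_head.
have lt_q' : (pa.1 + rho + (ins_word rho n w).1 < W)%N by rewrite ins_word1.
rewrite (@config_eval_ins_at _ _ _ _ _ _ lt_q'); last first.
  apply: leq_ltn_trans (level_ins_word _ _ _ _) _.
  have -> : Ordinal lt_q' = Ordinal lt_q by apply: val_inj; rewrite /= ins_word1.
  by rewrite -addnS; apply: lev; rewrite mem_head.
rewrite IH => [|pb lt_b pbn|pb pbn]; last first.
- by apply: ltW; rewrite in_cons pbn orbT.
- by rewrite (leq_trans _ (lev pb lt_b _)) ?in_cons ?pbn ?orbT//= leq_add2l.
by rewrite /word_eval big_cons lampM addnC lampD mulgA.
Qed.

End CommutingConjugates.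
Arguments config_eval {G J} t s {L K W} w.

(** * Bounded acyclicity from commuting conjugates *)

Section Generation.
Variable G : groupType.

Section PropGroup.
Variable P : G -> Prop.
Hypotheses (P1 : P 1%g) (PF : forall x y, P x -> P y -> P (x / y)%g).

(** A predicate with its closure properties is packaged as a [groupClosed]
    structure, so that generation can be used as an induction principle. *)
Definition group_pred of P 1%g & (forall x y, P x -> P y -> P (x / y)%g) : {pred G} :=
  [pred x | `[< P x >]].

Local Notation M := (group_pred P1 PF).

Fact group_pred1 : 1%g \in M. Proof. exact/asboolP. Qed.
Fact group_predV : {in M, forall x, x^-1%g \in M}.
Proof. by move=> x /asboolP Px; apply/asboolP; rewrite -[(x^-1)%g]mul1g; apply: PF. Qed.
Fact group_predM : {in M &, forall x y, (x * y)%g \in M}.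
Proof.
move=> x y /asboolP Px /group_predV/asboolP Py; apply/asboolP.
by rewrite -[y]invgK; apply: PF.
Qed.

HB.instance Definition _ := isMulClosed.Build G M group_predM.
HB.instance Definition _ := isMul1Closed.Build G M group_pred1.
HB.instance Definition _ := isInvClosed.Build G M group_predV.

Lemma generates_ind (S : set G) : generates S -> (forall x, S x -> P x) -> forall x, P x.
Proof.
by move=> genS SP x; apply/asboolP/(genS M) => y /SP Py; apply/asboolP.
Qed.
End PropGroup.

End Generation.

Section Acyclicity.
Variables (R : realType) (G : groupType) (J : finType) (t : G) (s : J -> G).
Hypothesis comm : forall k i j, (0 < k)%N -> commute (t ^+ k * s i * t ^- k)%g (s j).
Hypothesis sV : forall j, exists j', s j' = (s j)^-1%g.
Hypothesis gen : generates (fun x => x = t \/ exists j, x = s j).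
Hypothesis J_gt0 : (0 < #|J|)%N.

(** Conjugation by negative powers of [t] is absorbed in the outer factor
    [t ^- c], so that all sites are natural numbers. *)
Definition normal_form (d : nat * seq (nat * J) * nat) : G :=
  (t ^- d.1.1 * word_eval t s d.1.2 * t ^+ d.2)%g.

Lemma word_eval_shift q n :
  word_eval t s [seq ((q + pa.1)%N, pa.2) | pa <- n] = lamp t q (word_eval t s n).
Proof.
rewrite /word_eval; elim: n => [|pa n IH] /=; first by rewrite !big_nil lamp1.
by rewrite !big_cons lampM IH lampD.
Qed.

Lemma normal_formP x : exists d, x = normal_form d.
Proof.
pose P x := forall d, (exists d', x * normal_form d = normal_form d')%g /\
                      (exists d', x^-1 * normal_form d = normal_form d')%g.
suff /(_ ((0, [::]), 0)%N)[[d dE] _] : P x.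
  by exists d; rewrite -dE /normal_form /word_eval big_nil invg1 !mulg1.
have s_nf j d : exists d', (s j * normal_form d = normal_form d')%g.
  case: d => -[c n] e; exists ((c, (c, j) :: n), e).
  by rewrite /normal_form /word_eval /= big_cons /lamp /= !mulgA mulVg mul1g.
apply: (generates_ind _ _ gen) => {x} [d|x y Px Py d|x].
- by rewrite invg1 mul1g; split; exists d.
- rewrite invgF -!mulgA; split.
    by have [_ [d' ->]] := Py d; have [] := Px d'.
  by have [_ [d' ->]] := Px d; have [] := Py d'.
- case=> [->|[j ->] d]; last first.
    by split=> //; have [j' <-] := sV j.
  move=> [[c n] e]; split; last first.
    by exists ((c.+1, n), e); rewrite /normal_form /= expgSr invgM !mulgA.
  case: c => [|c]; last first.
    by exists ((c, n), e); rewrite /normal_form /= expgSr invgM !mulgA mulgV mul1g.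
  exists ((0%N, [seq ((1 + pa.1)%N, pa.2) | pa <- n]), e.+1).
  rewrite /normal_form /= word_eval_shift /lamp expg1 !expg0 invg1 !mul1g expgS.
  by rewrite !mulgA mulgVK.
Qed.

(** The two averages telescope: increasing [m] by 1 changes one term at each
    end of the interval. *)
Lemma avg_shift K m (H : G -> R) (M : R) : (forall g, `|H g| <= M) ->
  `|avg (fun j : 'I_K.+1 => H (t ^+ m * t ^- j)%g) - avg (fun j : 'I_K.+1 => H (t ^- j)%g)|
    <= (2 * m)%:R / K.+1%:R * M.
Proof.
move=> HM; elim: m => [|m IH].
  rewrite muln0 mul0r mul0r normr_le0 subr_eq0; apply/eqP/eq_avg => j.
  by rewrite mul1g.
rewrite -(subrKA (avg (fun j : 'I_K.+1 => H (t ^+ m * t ^- j)%g))).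
rewrite (le_trans (ler_normD _ _))// mulnS natrD 2!mulrDl lerD//.
rewrite /avg -mulrBl normrM [`|_^-1|]ger0_norm ?invr_ge0 ?ler0n//.
rewrite card_ord [leRHS]mulrAC; apply: ler_wpM2r; first by rewrite invr_ge0.
rewrite big_ord_recl big_ord_recr /=.
have -> : \sum_(j < K) H (t ^+ m.+1 * t ^- bump 0 j)%g = \sum_(j < K) H (t ^+ m * t ^- j)%g.
  apply: eq_bigr => j _; congr H.
  by rewrite /bump add1n !expgSr invgM !mulgA mulgK.
rewrite [X in X - _]addrC opprD addrACA subrr add0r (le_trans (ler_normB _ _))//.
by rewrite -[2%:R]/(1 + 1) mulrDl mul1r lerD.
Qed.

(** The three scales: [k.+1] displacements, [k.+1 ^ 2] random shifts, and twice
    as many sites, so that displacements are short compared to shifts and every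
    insertion falls inside the window. *)
Definition shifts k := (k * k.+2)%N.
Definition window k := (2 * (shifts k).+1)%N.
Notation lamps k := (config J k (shifts k) (window k)).
Notation sample := (config_eval t s).

(** The first summand bounds the cost of changing the random shift, the second
    one the cost of overflowing words. *)
Definition error (l : nat) (d : nat * seq (nat * J) * nat) : nat :=
  (2 * (l + d.2) + 2 * size d.1.2 ^ 2)%N.

(** The translate by [t ^+ rho * normal_form d] is first replaced by that by the
    displaced letters alone, as the remaining powers of [t] are absorbed by the
    random shift; these letters are then inserted in the random words. *)
Lemma law_translate k l (r : 'I_k.+1) d (F : G -> R) (M : R) :
  (l <= k)%N -> (d.1.1 <= l)%N -> (forall pa, pa \in d.1.2 -> pa.1 < l)%N ->
  (forall g, `|F g| <= M) ->
  `|law (fun w : lamps k => t ^+ (l * r.+1) * normal_form d * sample w)%g F -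
    law (fun w : lamps k => sample (ins_word (l * r.+1 - d.1.1) d.1.2 w)) F|
  <= (error l d)%:R / k.+1%:R * M.
Proof.
case: d => -[c n] e /= lk cl nl FM.
set rho := (l * r.+1)%N; set n' := lamp t (rho - c) (word_eval t s n).
have M0 : 0 <= M by apply: le_trans (FM 1%g).
have c_rho : (c <= rho)%N by rewrite (leq_trans cl)// leq_pmulr.
have Kk : (shifts k).+1 = (k.+1 * k.+1)%N by rewrite /shifts; lia.
have fit : (rho + (l + (shifts k).+1) <= window k)%N.
  have := ltn_ord r; rewrite /rho /window; nia.
pose mid (F : G -> R) := law (fun w : lamps k => n' * sample w)%g F.
rewrite -(subrKA (mid F)) (le_trans (ler_normD _ _))//.
rewrite /error /= natrD 2!mulrDl lerD//.
  have lamps0 : (0 < #|{ffun 'I_(window k) -> site J k}|)%N.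
    by rewrite card_ffun expn_gt0 site_gt0.
  pose H g := avg (fun x : {ffun 'I_(window k) -> site J k} => F (n' * g * lamps_eval t s x)%g).
  have HM g : `|H g| <= M by apply: avg_bounded.
  rewrite /mid /law !avg_pair /=.
  have -> : avg (fun j : 'I_(shifts k).+1 => avg (fun x : {ffun 'I_(window k) -> site J k} =>
      F (t ^+ rho * normal_form (c, n, e) * sample (j, x))%g)) =
    avg (fun j : 'I_(shifts k).+1 => H (t ^+ (rho - c + e) * t ^- j)%g).
    apply: eq_avg => j; apply: eq_avg => x; congr F.
    rewrite /n' /lamp /normal_form /config_eval /= -{1}(subnK c_rho) !expgnDr.
    by rewrite !mulgA mulgK mulgVK.
  have -> : avg (fun j : 'I_(shifts k).+1 => avg (fun x : {ffun 'I_(window k) -> site J k} =>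
      F (n' * sample (j, x))%g)) = avg (fun j : 'I_(shifts k).+1 => H (t ^- j)%g).
    by apply: eq_avg => j; apply: eq_avg => x; rewrite /config_eval /= mulgA.
  apply: le_trans (avg_shift _ _ HM) _; apply: ler_wpM2r => //.
  rewrite ler_pdivrMr ?ltr0n// mulrAC ler_pdivlMr ?ltr0n// -!natrM ler_nat Kk.
  by have := ltn_ord r; rewrite /rho; nia.
have win0 : (0 < window k)%N by [].
(* The default value is never reached, as all addresses fit in the window. *)
pose idx q : 'I_(window k) := insubd (Ordinal win0) q.
pose bad (w : lamps k) :=
  (\sum_(pa <- n) (k < level (w.2 (idx (pa.1 + (rho - c) + w.1))) + size n))%N.
have bad_avg : avg (fun w => (bad w)%:R) <= (size n ^ 2)%:R / k.+1%:R :> R.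
  rewrite /bad; under eq_avg do rewrite natr_sum.
  rewrite avg_sum.
  apply: (@le_trans _ _ (\sum_(pa <- n) ((size n)%:R / k.+1%:R))); last first.
    by rewrite big_const_seq count_predT iter_addr_0 -mulrnAl -mulrnA mulnn.
  apply: ler_sum => pa _; rewrite avg_pair /=.
  rewrite -[leRHS](@avg_cst R 'I_(shifts k).+1) ?card_ord//; apply: ler_avg => j.
  rewrite (@avg_ffun_coord R _ _ (idx (pa.1 + (rho - c) + (j : 'I__))%N)
    (fun u => (k < level u + size n)%N%:R)) ?site_gt0//.
  exact: avg_level.
have pointwise (w : lamps k) :
    `|F (n' * sample w)%g - F (sample (ins_word (rho - c) n w))| <= 2 * M * (bad w)%:R.
  case: (posnP (bad w)) => [bad0|bad1]; last first.
    apply: (@le_trans _ _ (2 * M)); last by rewrite ler_peMr ?mulr_ge0// ler1n.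
    by rewrite (le_trans (ler_normB _ _))// mulrDl mul1r lerD.
  have lt_q pa : pa \in n -> (pa.1 + (rho - c) + w.1 < window k)%N.
    move=> /nl; move: (nat_of_ord _) (ltn_ord w.1) fit (pa.1) => j lt_j.
    by move: (window k) (shifts k) lt_j => W K; lia.
  rewrite bad0 mulr0 (config_eval_ins_word comm) ?subrr ?normr0//.
  move=> pa lt_pa pan; rewrite leqNgt; apply/negP => lev.
  move: bad0; rewrite /bad (big_rem pa)//= /idx.
  have -> : insubd (Ordinal win0) (pa.1 + (rho - c) + w.1)%N = Ordinal lt_pa.
    by apply: val_inj; rewrite val_insubd lt_pa.
  by rewrite lev.
rewrite /law -avgB (le_trans (ler_norm_avg _))//.
apply: le_trans (ler_avg pointwise) _.
rewrite avgZ; apply: le_trans (ler_wpM2l _ bad_avg) _; first by rewrite mulr_ge0.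
by rewrite natrM -!mulrA [M * _]mulrC -!mulrA.
Qed.

Lemma lawB (T : finType) (y : T -> G) (F H : G -> R) :
  law y (fun z => F z - H z) = law y F - law y H.
Proof. exact: avgB. Qed.

Lemma law_bounded (T : finType) (y : T -> G) (F : G -> R) (M : R) :
  (0 < #|T|)%N -> (forall z, `|F z| <= M) -> `|law y F| <= M.
Proof. by move=> T0 FM; apply: avg_bounded => // w; apply: FM. Qed.

Lemma smooth_translate (T : finType) (y : T -> G) (f : seq G -> R) l a :
  smooth y f [seq a * z | z <- l]%g = smooth y (fun c => f [seq a * z | z <- c]%g) l.
Proof.
elim: l f => [//|x l IH] f; apply: eq_avg => w /=; rewrite -!mulgA.
by rewrite -[LHS]/(smooth y _ _) IH.
Qed.

(** The value of a smoothed invariant cochain does not change under diagonal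
    translation by [t ^+ (l * r.+1)], for every [r]; averaging over [r] brings
    [mixing] into play.  The spacing [l] exceeds the diameter of the set of
    letters of each entry, so that different [r] use different sites. *)
Lemma smooth_estimate (f : seq G -> R) (B : R) (ds : seq (nat * seq (nat * J) * nat))
    l k (eta : R) :
  (forall c, `|f c| <= B) -> (forall a c, f [seq a * z | z <- c]%g = f c) ->
  (forall d, d \in ds -> d.1.1 <= l)%N ->
  (forall d, d \in ds -> forall pa, pa \in d.1.2 -> pa.1 < l)%N ->
  (l <= k)%N -> 0 < eta ->
  `|smooth (sample : lamps k -> G) f [seq normal_form d | d <- ds] -
    smooth (sample : lamps k -> G) f (nseq (size ds) 1%g)| <=
  (\sum_(d <- ds) (error l d)%:R / k.+1%:R) * B +
  B * (eta + (\prod_(d <- ds) #|J| ^ size d.1.2)%N%:R / (eta * k.+1%:R)).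
Proof.
move=> fB fT cl nl lk eta0.
pose act (r : 'I_k.+1) (d : nat * seq (nat * J) * nat) : lamps k -> lamps k := ins_word (l * r.+1 - d.1.1) d.1.2.
pose A r := iter_law [seq law (sample \o act r d) | d <- ds] f.
have -> : smooth (sample : lamps k -> G) f (nseq (size ds) 1%g) =
    iter_law [seq law (sample : lamps k -> G) | d <- ds] f.
  rewrite /smooth; congr iter_law.
  elim: ds {cl nl A} => [//|d ds IH] /=; congr (_ :: _) => //.
  by congr law; apply/funext => w; rewrite mul1g.
rewrite -(subrKA (avg A)) (le_trans (ler_normD _ _))// lerD//; last first.
  have := @mixing R G 'I_k.+1 (lamps k) _ sample act (fun d => #|J| ^ size d.1.2)%N ds f B eta.
  rewrite !card_ord; apply => //.
  - exact: config_gt0.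
  - by move=> r d; apply: thin_ins_word.
  - move=> r r' d rr' dds; apply: amalgam_ins_word => pa pb pan pbn.
    have cd := cl _ dds; have pal := nl _ dds _ pan; have pbl := nl _ dds _ pbn.
    have rr'_lt : (r < r')%N || (r' < r)%N by rewrite -neq_ltn.
    apply/negP => /eqP e.
    have step i j : (i < j)%N -> (l * i.+1 + l <= l * j.+1)%N.
      by move=> ij; rewrite addnC -mulnS leq_mul2l ltnS ij orbT.
    have base i : (d.1.1 <= l * i.+1)%N by rewrite (leq_trans cd)// leq_pmulr.
    move: e pal pbl cd (base r) (base r'); move: (pa.1) (pb.1) (d.1.1) => p q c.
    by case/orP: rr'_lt => /step; move: (l * r.+1)%N (l * r'.+1)%N => i j; lia.
have A_close r : `|smooth (sample : lamps k -> G) f [seq normal_form d | d <- ds] - A r| <=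
    (\sum_(d <- ds) (error l d)%:R / k.+1%:R) * B.
  rewrite -[in X in smooth _ X](_ : (fun c => f [seq t ^+ (l * r.+1) * z | z <- c]%g) = f); last first.
    by apply/funext => c; apply: fT.
  rewrite -smooth_translate /smooth -!map_comp.
  apply: (@iter_law_lip _ _ _ (fun d => law (fun w : lamps k => t ^+ (l * r.+1) * normal_form d * sample w)%g)
     (fun d => law (sample \o act r d)) (fun d => (error l d)%:R / k.+1%:R)) => //.
  - by move=> d F H _; apply: lawB.
  - by move=> d F M _; apply: law_bounded; apply: config_gt0.
  - by move=> d F M _; apply: law_bounded; apply: config_gt0.
  - by move=> d F M dds FM; apply: law_translate => //; [exact: cl|exact: nl].
rewrite -[X in X - _](@avg_cst R 'I_k.+1) ?card_ord// -avgB.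
by apply: avg_bounded; rewrite ?card_ord.
Qed.

Local Open Scope classical_set_scope.

(** The error terms of [smooth_estimate] tend to 0 as [k] grows, once [eta] has
    been chosen small. *)
Theorem acyclic_of_commuting_conjugates : boundedly_acyclic R G.
Proof.
apply: (@acyclic_of_smoothing R G (fun k => lamps k) (fun k => sample)).
  by move=> k; apply: config_gt0.
move=> f B l fB fT.
have [ds ->] : exists ds, l = [seq normal_form d | d <- ds].
  elim: l => [|x l [ds ->]]; first by exists [::].
  by have [d ->] := normal_formP x; exists (d :: ds).
have B0 : 0 <= B by apply: le_trans (fB [::]).
pose lb := (\max_(d <- ds) maxn d.1.1 (\max_(pa <- d.1.2) pa.1.+1))%N.
have lbd d : d \in ds -> (maxn d.1.1 (\max_(pa <- d.1.2) pa.1.+1) <= lb)%N.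
  by move=> dds; apply: (@leq_bigmax_seq _ ds xpredT (fun d => maxn d.1.1 _) d).
have cl d : d \in ds -> (d.1.1 <= lb)%N by move=> /lbd; rewrite geq_max => /andP[].
have nl d : d \in ds -> forall pa, pa \in d.1.2 -> (pa.1 < lb)%N.
  move=> /lbd; rewrite geq_max => /andP[_ H] pa pad; apply: leq_trans H.
  exact: (@leq_bigmax_seq _ d.1.2 xpredT (fun pa => pa.1.+1) pa).
apply/cvgrPdist_le => eps eps0.
pose eta := eps / (2 * (B + 1)).
have eta0 : 0 < eta by rewrite divr_gt0// mulr_gt0// ltr_wpDl.
pose X := (\sum_(d <- ds) (error lb d)%:R) * B +
  B * ((\prod_(d <- ds) #|J| ^ size d.1.2)%N%:R / eta).
have X_to0 : (fun k => X * harmonic k) @ \oo --> (0 : R).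
  by rewrite -(mulr0 X); apply: cvgM; [exact: cvg_cst|exact: cvg_harmonic].
have /cvgrPdist_le/(_ (eps / 2)) := X_to0.
rewrite divr_gt0// => /(_ isT) Xsmall.
near=> k.
rewrite sub0r normrN size_map.
apply: le_trans (smooth_estimate fB fT cl nl _ eta0) _; first by near: k; exact: nbhs_infty_ge.
have : `|0 - X * harmonic k| <= eps / 2 by near: k.
rewrite sub0r normrN => /(le_trans (ler_norm _)) Xk.
have Beta : B * eta <= eps / 2.
  rewrite /eta mulrA ler_pdivrMr ?mulr_gt0// ?ltr_wpDl//.
  by have -> : eps / 2 * (2 * (B + 1)) = (B + 1) * eps; [field|apply: ler_wpM2r; [exact: ltW|rewrite lerDl]].
rewrite -mulr_suml mulrDr addrCA [leRHS](splitr eps) lerD//.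
apply: le_trans _ Xk; rewrite /X /harmonic /= le_eqVlt; apply/orP; left; apply/eqP.
by rewrite invfM; ring.
Unshelve. all: by end_near.
Qed.

End Acyclicity.

(** * Groups of bijections and spanned subgroups *)

Section Bijections.
Variable T : Type.

Record bij := Bij {
  bij_fun :> T -> T;
  bij_inv : T -> T;
  bij_funK : cancel bij_fun bij_inv;
  bij_invK : cancel bij_inv bij_fun }.

Lemma bij_ext (f g : bij) : f =1 g -> f = g.
Proof.
case: f g => [f f' fK f'K] [g g' gK g'K] /= /funext fg.
rewrite {f}fg in fK f'K *.
have e : f' = g' by apply/funext => x; rewrite -{1}[x]g'K fK.
rewrite {f'}e in fK f'K *.
by rewrite (Prop_irrelevance fK gK) (Prop_irrelevance f'K g'K).
Qed.

HB.instance Definition _ := gen_eqMixin bij.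
HB.instance Definition _ := gen_choiceMixin bij.

Definition bij_one : bij := @Bij id id (fun=> erefl) (fun=> erefl).
Definition bij_mul (f g : bij) : bij :=
  Bij (can_comp (bij_funK f) (bij_funK g)) (can_comp (bij_invK g) (bij_invK f)).
Definition bij_opp (f : bij) : bij := Bij (bij_invK f) (bij_funK f).

Fact bij_mulA : associative bij_mul. Proof. by move=> f g h; apply: bij_ext. Qed.
Fact bij_mul1g : left_id bij_one bij_mul. Proof. by move=> f; apply: bij_ext. Qed.
Fact bij_mulg1 : right_id bij_one bij_mul. Proof. by move=> f; apply: bij_ext. Qed.
Fact bij_mulVg : left_inverse bij_one bij_opp bij_mul.
Proof. by move=> f; apply: bij_ext => x /=; rewrite bij_funK. Qed.
Fact bij_mulgV : right_inverse bij_one bij_opp bij_mul.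
Proof. by move=> f; apply: bij_ext => x /=; rewrite bij_invK. Qed.

HB.instance Definition _ := isGroup.Build bij bij_mulA bij_mul1g bij_mulg1 bij_mulVg bij_mulgV.

Lemma bijM (f g : bij) x : (f * g)%g x = f (g x). Proof. by []. Qed.
Lemma bijVK (f : bij) x : f ((f^-1)%g x) = x. Proof. exact: bij_invK. Qed.
Lemma bijX (f : bij) n x : (f ^+ n)%g x = iter n f x.
Proof. by elim: n => [//|n IH]; rewrite expgS bijM IH. Qed.

End Bijections.

Section Span.
Variables (G : groupType) (S : set G).

Definition in_span : pred G :=
  [pred x | `[< forall H : groupClosed G, (forall s, S s -> s \in H) -> x \in H >]].

Fact in_span_group_closed : group_closed in_span.
Proof.
split=> [|x y /asboolP Hx /asboolP Hy]; apply/asboolP => H SH; first exact: gpred1.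
by rewrite gpredF ?Hx ?Hy.
Qed.

Record span := Span { span_val :> G ; spanP : span_val \in in_span }.
HB.instance Definition _ := [isSub for span_val].
HB.instance Definition _ := [Choice of span by <:].
HB.instance Definition _ := SubChoice_isSubGroup.Build G in_span span in_span_group_closed.

Fact mem_span s : S s -> s \in in_span.
Proof. by move=> Ss; apply/asboolP => H; apply. Qed.

Definition span_gen s (Ss : S s) : span := Span (mem_span Ss).

Lemma span_ind (P : G -> Prop) : P 1%g -> (forall x y, P x -> P y -> P (x / y)%g) ->
  (forall s, S s -> P s) -> forall x : span, P (val x).
Proof.
move=> P1 PF SP x; have /asboolP/(_ (group_pred P1 PF)) H := spanP x.
by apply/asboolP/H => s /SP Ps; apply/asboolP.
Qed.

Lemma span_generates : generates (fun x : span => S (val x)).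
Proof.
move=> H SH x.
suff [y /val_inj <-] : exists2 y : span, val y = val x & y \in H by [].
apply: (@span_ind (fun g => exists2 y : span, val y = g & y \in H)) x => [|_ _ [x <- xH] [y <- yH]|s Ss].
- by exists 1%g; rewrite ?gpred1.
- by exists (x / y)%g; rewrite ?gpredF.
- by exists (span_gen Ss) => //; apply: SH.
Qed.

Lemma span_valV (x : span) : val (x^-1)%g = ((val x)^-1)%g.
Proof. by apply: (@mulgI _ (val x)); rewrite -valM !mulgV val1. Qed.

Lemma span_valX (x : span) n : val (x ^+ n)%g = (val x ^+ n)%g.
Proof. by elim: n => [|n IH]; rewrite ?val1// !expgS valM IH. Qed.

End Span.

(** * A ping-pong pair of homeomorphisms of the line *)

Section PeriodicHomeomorphisms.
Variable R : realType.
Implicit Types x y z : R.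

(** The greatest multiple of 4 not exceeding [z]. *)
Definition base z : R := (Num.floor (z / 4))%:~R * 4.
(** The position on the circle of circumference 4. *)
Definition pos z : R := z - base z.

Lemma pos_itv z : 0 <= pos z < 4.
Proof.
have /andP[lo hi] := floor_itv (z / 4).
move: lo hi; rewrite /pos /base ler_pdivlMr// ltr_pdivrMr// intrD => lo hi.
by apply/andP; split; lra.
Qed.

Lemma base_uniq z (k : int) r : 0 <= r < 4 -> z = k%:~R * 4 + r -> base z = k%:~R * 4.
Proof.
case/andP=> r0 r4 ->; rewrite /base (@floor_def _ _ k)// intrD.
by rewrite ler_pdivlMr// ltr_pdivrMr//; apply/andP; split; lra.
Qed.

Lemma base_add z r : 0 <= r < 4 -> base (base z + r) = base z.
Proof. by move=> r4; rewrite {1}[base z]/base (base_uniq r4 erefl). Qed.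

Lemma base_pos z : base z + pos z = z.
Proof. by rewrite /pos addrC subrK. Qed.

(** The lift to the line of a map of the circle that fixes 0. *)
Definition lift_fun (psi : R -> R) z : R := base z + psi (pos z).

Lemma pos_lift (psi : R -> R) z : (forall r, 0 <= r < 4 -> 0 <= psi r < 4) ->
  pos (lift_fun psi z) = psi (pos z).
Proof.
by move=> psi4; rewrite /pos [lift_fun _ _]/lift_fun base_add ?psi4 ?pos_itv// addrC addKr.
Qed.

(** This stretches the arc from 0 to 1 over three quarters of the circle and
    squeezes the rest into the last quarter; composed with rotations by 1 on
    either side it gives the two ping-pong maps. *)
Definition expand r : R := if r < 1 then 3 * r else 3 + (r - 1) / 3.
Definition contract r : R := if r < 3 then r / 3 else 1 + 3 * (r - 3).

Lemma expand_itv r : 0 <= r < 4 -> 0 <= expand r < 4.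
Proof. by move=> /andP[? ?]; rewrite /expand; case: ltrP => ?; apply/andP; split; lra. Qed.

Lemma contract_itv r : 0 <= r < 4 -> 0 <= contract r < 4.
Proof. by move=> /andP[? ?]; rewrite /contract; case: ltrP => ?; apply/andP; split; lra. Qed.

Lemma expandK r : contract (expand r) = r.
Proof. by rewrite /expand; case: ltrP => ?; rewrite /contract; case: ltrP => ?; lra. Qed.

Lemma contractK r : expand (contract r) = r.
Proof. by rewrite /contract; case: ltrP => ?; rewrite /expand; case: ltrP => ?; lra. Qed.

Lemma expand_lt r r' : r < r' -> expand r < expand r'.
Proof. by rewrite /expand; case: (ltrP r 1) => ?; case: (ltrP r' 1) => ?; lra. Qed.

Lemma contract_lt r r' : r < r' -> contract r < contract r'.
Proof. by rewrite /contract; case: (ltrP r 3) => ?; case: (ltrP r' 3) => ?; lra. Qed.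

Lemma lift_lt (psi : R -> R) z z' : (forall r, 0 <= r < 4 -> 0 <= psi r < 4) ->
  (forall r r', r < r' -> psi r < psi r') -> z < z' -> lift_fun psi z < lift_fun psi z'.
Proof.
move=> psi4 psi_lt zz'; rewrite /lift_fun.
have /andP[p0 p4] := psi4 _ (pos_itv z); have /andP[q0 q4] := psi4 _ (pos_itv z').
have : (Num.floor (z / 4) <= Num.floor (z' / 4)).
  by apply: le_floor; rewrite ler_pM2r// ltW.
rewrite le_eqVlt => /orP[/eqP e|].
  have bb : base z = base z' by rewrite /base e.
  by rewrite bb ltrD2l; apply: psi_lt; rewrite /pos bb ltrD2r.
rewrite -lezD1 -(ler_int R) intrD /base => *; lra.
Qed.

Definition lift_expand z := lift_fun expand z.
Definition lift_contract z := lift_fun contract z.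

Lemma lift_expandK : cancel lift_expand lift_contract.
Proof.
move=> z; rewrite /lift_contract /lift_fun (pos_lift _ expand_itv) expandK.
by rewrite [in base _]/lift_expand base_add ?base_pos// expand_itv// pos_itv.
Qed.

Lemma lift_contractK : cancel lift_contract lift_expand.
Proof.
move=> z; rewrite /lift_expand /lift_fun (pos_lift _ contract_itv) contractK.
by rewrite [in base _]/lift_contract base_add ?base_pos// contract_itv// pos_itv.
Qed.

Definition pong_a z := lift_expand z - 1.
Definition pong_a' z := lift_contract (z + 1).
Definition pong_b z := lift_expand (z - 1).
Definition pong_b' z := lift_contract z + 1.

Lemma pong_aK : cancel pong_a pong_a'.
Proof. by move=> z; rewrite /pong_a /pong_a' subrK lift_expandK. Qed.
Lemma pong_a'K : cancel pong_a' pong_a.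
Proof. by move=> z; rewrite /pong_a /pong_a' lift_contractK addrK. Qed.
Lemma pong_bK : cancel pong_b pong_b'.
Proof. by move=> z; rewrite /pong_b /pong_b' lift_expandK subrK. Qed.
Lemma pong_b'K : cancel pong_b' pong_b.
Proof. by move=> z; rewrite /pong_b /pong_b' addrK lift_contractK. Qed.

Lemma pong_a0 : pong_a 0 = -1.
Proof.
by rewrite /pong_a /lift_expand /lift_fun /pos /base !mul0r floor0 mul0r subr0 /expand ltr01 mulr0 !add0r.
Qed.

Lemma pong_b0 : pong_b 0 = - (1 / 3).
Proof.
have bE : base (- 1) = - 4.
  by rewrite (@base_uniq _ (-1) 3) ?mulN1r //; [apply/andP; split; lra|lra].
rewrite /pong_b sub0r /lift_expand /lift_fun /pos bE /expand.
by case: ltrP => ?; lra.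
Qed.

Lemma lift_expand_lt z z' : z < z' -> lift_expand z < lift_expand z'.
Proof. exact: (lift_lt expand_itv expand_lt). Qed.
Lemma lift_contract_lt z z' : z < z' -> lift_contract z < lift_contract z'.
Proof. exact: (lift_lt contract_itv contract_lt). Qed.

Definition arc (i : nat) z : Prop := i%:R <= pos z < i.+1%:R.

Lemma arc_disj i j z : arc i z -> arc j z -> i = j.
Proof.
move=> /andP[a b] /andP[c d]; apply/eqP; rewrite eqn_leq; apply/andP; split.
  by rewrite -ltnS -(ltr_nat R) (le_lt_trans a d).
by rewrite -ltnS -(ltr_nat R) (le_lt_trans c b).
Qed.

Lemma pos_sub1 z : (1 <= pos z -> pos (z - 1) = pos z - 1) /\
  (pos z < 1 -> pos (z - 1) = pos z + 3).
Proof.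
have zE := base_pos z; have /andP[z0 z4] := pos_itv z.
split=> z1.
  rewrite {1}/pos (@base_uniq _ (Num.floor (z / 4)) (pos z - 1)) -/(base z).
  - by lra.
  - by apply/andP; split; lra.
  - by lra.
pose k := Num.floor (z / 4).
have kE : (k - 1)%:~R * 4 = base z - 4 by rewrite intrB mulrBl mul1r.
suff e : base (z - 1) = base z - 4 by rewrite /pos e; lra.
rewrite -kE; apply: (@base_uniq _ _ (pos z + 3)); first by apply/andP; split; lra.
by rewrite kE; lra.
Qed.

Lemma pong_a_arc z : ~ arc 0 z -> arc 2 (pong_a z).
Proof.
rewrite /arc /pong_a => z0; have /andP[p0 p4] := pos_itv z.
have z1 : 1 <= pos z by rewrite leNgt; apply/negP => ?; apply: z0; apply/andP; split; lra.
have := pos_lift z expand_itv; rewrite -/(lift_expand z) /expand ltNge z1 /= => e.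
have [down _] := pos_sub1 (lift_expand z).
by rewrite down e; [apply/andP; split|]; lra.
Qed.

Lemma pong_b_arc z : ~ arc 1 z -> arc 3 (pong_b z).
Proof.
rewrite /arc /pong_b => z0; have /andP[p0 p4] := pos_itv z.
have z1 : 1 <= pos (z - 1).
  have [H1 H2] := pos_sub1 z; case: (lerP 1 (pos z)) => h.
    rewrite (H1 h) leNgt; apply/negP => ?; apply: z0; apply/andP; split; lra.
  by rewrite (H2 h); lra.
have := pos_lift (z - 1) expand_itv; rewrite -/(lift_expand (z - 1)) => ->.
by have /andP[? ?] := pos_itv (z - 1); rewrite /expand ltNge z1 /=; apply/andP; split; lra.
Qed.

End PeriodicHomeomorphisms.

(** * The generators *)

(** By Bezout. *)
Lemma expr_coprime (F : fieldType) (x : F) m n :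
  (0 < m)%N -> coprime m n -> x ^+ m = 1 -> x ^+ n = 1 -> x = 1.
Proof.
move=> m0 co xm xn; have [km kn e _] := egcdnP n m0.
move: e; rewrite (eqP co) => e.
have : x ^+ (km * m) = x ^+ (kn * n + 1) by rewrite e.
by rewrite mulnC exprM xm expr1n exprD mulnC exprM xn expr1n mul1r.
Qed.

Section Concrete.
Variables (R : realType) (A : {pred nat}).

(** The coordinates are the level moved by [t], the copy moved by [u] at level
    0, and a point of a line on which [a] and [b] act in copy 0 of level 0. *)
Definition point := (int * int * R)%type.
Definition space := (point * algC)%type.

Definition lex_lt (y y' : point) : bool :=
  (y.1.1 < y'.1.1) || (y.1.1 == y'.1.1) &&
  ((y.1.2 < y'.1.2) || (y.1.2 == y'.1.2) && (y.2 < y'.2)).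

Lemma lex_lt_irr y : lex_lt y y = false.
Proof. by rewrite /lex_lt !ltxx !andbF. Qed.

Lemma lex_lt_trans : transitive lex_lt.
Proof.
move=> [[n2 m2] z2] [[n1 m1] z1] [[n3 m3] z3]; rewrite /lex_lt /=.
case: (ltgtP n1 n2) => // n12; case: (ltgtP n2 n3) => // n23 /=; subst => //.
- by rewrite (lt_trans n12 n23).
- by rewrite n12.
- by rewrite n23.
rewrite ltxx eqxx /=.
case: (ltgtP m1 m2) => // m12; case: (ltgtP m2 m3) => // m23 /=; subst => //.
- by rewrite (lt_trans m12 m23).
- by rewrite m12.
- by rewrite m23.
by rewrite ltxx eqxx /=; apply: lt_trans.
Qed.

Lemma lex_lt_total y y' : y != y' -> lex_lt y y' || lex_lt y' y.
Proof.
case: y y' => [[n m] z] [[n' m'] z']; rewrite /lex_lt /= !xpair_eqE.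
by case: (ltgtP n n') => // _; case: (ltgtP m m') => // _; case: (ltgtP z z').
Qed.

Definition unity_root (p : nat) : algC :=
  if pselect (0 < p)%N is left p0 then sval (C_prim_root_exists p0) else 1.

(** The factor by which [v] multiplies over [y]: a primitive root of unity of
    order [p] at the origin of copy [p] of level 0, for each prime [p] in [A].
    The copies move as a block under [u] whereas conjugates of [a] move the
    origin of one copy only, so that the primes can be separated. *)
Definition weight (y : point) : algC :=
  if (y.1.1 == 0) && (y.2 == 0) then
    if y.1.2 is Posz p then if prime p && (p \in A) then unity_root p else 1 else 1
  else 1.

Lemma unity_rootP p : (0 < p)%N -> p.-primitive_root (unity_root p).
Proof. by rewrite /unity_root; case: pselect => // p0 _; case: C_prim_root_exists. Qed.

(** The group of roots of unity whose order has all its prime factors in [A]. *)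
Definition order_in (x : algC) : Prop :=
  exists n, [/\ (0 < n)%N, x ^+ n = 1 & forall q, prime q -> q \notin A -> coprime q n].

Lemma order_in1 : order_in 1.
Proof. by exists 1%N; split=> // q _ _; rewrite coprimen1. Qed.

Lemma order_inM x y : order_in x -> order_in y -> order_in (x * y).
Proof.
move=> [m [m0 xm cm]] [n [n0 yn cn]]; exists (m * n)%N; split.
- by rewrite muln_gt0 m0.
- by rewrite exprMn exprM xm expr1n mulnC exprM yn expr1n mulr1.
- by move=> q pq qA; rewrite coprimeMr cm// cn.
Qed.

Lemma order_inV x : order_in x -> order_in x^-1.
Proof. by move=> [m [m0 xm cm]]; exists m; split=> //; rewrite exprVn xm invr1. Qed.

Lemma order_in_weight y : order_in (weight y).
Proof.
rewrite /weight; case: ifP => _; last exact: order_in1.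
case: (y.1.2) => p; last exact: order_in1.
case: ifP => [/andP[pp pA]|_]; last exact: order_in1.
exists p; split; rewrite ?prime_gt0//.
  exact/prim_expr_order/unity_rootP/prime_gt0.
move=> q qq qA; rewrite prime_coprime// dvdn_prime2//.
by apply: contra qA => /eqP ->.
Qed.

Lemma weight_neq0 y : weight y != 0.
Proof.
have [n [n0 wn _]] := order_in_weight y; apply/eqP => w0.
by move/eqP: wn; rewrite w0 expr0n gtn_eqF// eq_sym oner_eq0.
Qed.

Section Generators.

Definition shift_fun (e : int) (w : space) : space :=
  ((w.1.1.1 + e, w.1.1.2, w.1.2), w.2).
Definition bump_fun (e : int) (w : space) : space :=
  ((w.1.1.1, w.1.1.2 + (if w.1.1.1 == 0 then e else 0), w.1.2), w.2).
Definition local_fun (h : R -> R) (w : space) : space :=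
  ((w.1.1, if w.1.1 == (0, 0) then h w.1.2 else w.1.2), w.2).
Definition mult_fun (k : point -> algC) (w : space) : space := (w.1, k w.1 * w.2).

Fact shift_funK e : cancel (shift_fun e) (shift_fun (- e)).
Proof. by case=> [[[n m] z] c]; rewrite /shift_fun /= addrK. Qed.
Fact bump_funK e : cancel (bump_fun e) (bump_fun (- e)).
Proof.
by case=> [[[n m] z] c]; rewrite /bump_fun /=; case: eqP; rewrite ?addrK ?addr0.
Qed.
Fact local_funK h h' : cancel h h' -> cancel (local_fun h) (local_fun h').
Proof.
by move=> hK [[nm z] c]; rewrite /local_fun /=; case: eqP => // _; rewrite hK.
Qed.
Fact mult_funK k : (forall y, k y != 0) -> cancel (mult_fun k) (mult_fun (fun y => (k y)^-1)).
Proof. by move=> k0 [y c]; rewrite /mult_fun /= mulKf. Qed.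

Fact shift_funVK e : cancel (shift_fun (- e)) (shift_fun e).
Proof. by rewrite -{2}[e]opprK; apply: shift_funK. Qed.
Fact bump_funVK e : cancel (bump_fun (- e)) (bump_fun e).
Proof. by rewrite -{2}[e]opprK; apply: bump_funK. Qed.
Fact mult_funVK : cancel (mult_fun (fun y => (weight y)^-1)) (mult_fun weight).
Proof. by move=> [y c]; rewrite /mult_fun /= mulVKf// weight_neq0. Qed.

Definition gen_t : bij space := Bij (shift_funK 1) (shift_funVK 1).
Definition gen_u : bij space := Bij (bump_funK 1) (bump_funVK 1).
Definition gen_a : bij space :=
  Bij (local_funK (@pong_aK R)) (local_funK (@pong_a'K R)).
Definition gen_b : bij space :=
  Bij (local_funK (@pong_bK R)) (local_funK (@pong_b'K R)).
Definition gen_v : bij space := Bij (mult_funK weight_neq0) mult_funVK.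

Definition gens : seq (bij space) := [:: gen_a; gen_b; gen_u; gen_v; gen_t].

End Generators.

Definition lamplighter : groupType := span [set g | g \in gens].

End Concrete.

(** * Supports, monomial form and torsion *)

Section Properties.
Variables (R : realType) (A : {pred nat}).
Notation space := (space R).
Notation point := (point R).
Implicit Types (g : bij space) (w : space) (y : point).

(** Level [e] is preserved as well as its complement, on which [g] is trivial. *)
Definition supported_at (e : int) g : Prop :=
  forall w, (g w).1.1.1 = w.1.1.1 /\ (w.1.1.1 != e -> g w = w).

Lemma supported_at_commute e e' g g' :
  e != e' -> supported_at e g -> supported_at e' g' -> commute g g'.
Proof.
move=> ee' sg sg'; apply: bij_ext => w; rewrite !bijM.
have [ng idg] := sg w; have [ng' idg'] := sg' w.
case: (eqVneq w.1.1.1 e) => we.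
  rewrite idg'; last by rewrite we.
  by have [_ ->] := sg' (g w); rewrite // ng we.
rewrite (idg we); have [_ ->//] := sg (g' w).
by rewrite ng'.
Qed.

Lemma supported_atV e g : supported_at e g -> supported_at e (g^-1)%g.
Proof.
move=> sg w; have := sg ((g^-1)%g w); rewrite bijVK => -[nw idw].
by split=> // we; apply/esym/idw; rewrite -nw.
Qed.

Lemma gen_tX k w : (gen_t R ^+ k)%g w = shift_fun k%:Z w.
Proof.
rewrite bijX; elim: k w => [|k IH] [[[n m] z] c] /=; rewrite ?IH /shift_fun /= ?addr0//.
by rewrite -addrA -[k.+1]addn1 PoszD.
Qed.

Lemma supported_at_conj k g : supported_at 0 g ->
  supported_at k%:Z (gen_t R ^+ k * g * gen_t R ^- k)%g.
Proof.
move=> sg w; rewrite !bijM.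
have : (gen_t R ^+ k)%g ((gen_t R ^- k)%g w) = w by rewrite bijVK.
set w' := ((gen_t R ^- k)%g w); rewrite gen_tX => <-; rewrite !gen_tX /=.
have [-> idg] := sg w'; split=> // wk; rewrite idg//.
by apply: contra wk => /eqP ->; rewrite add0r.
Qed.

Lemma supported_local h g : (g : space -> space) =1 local_fun h -> supported_at 0 g.
Proof.
move=> gE [[[n m] z] c]; rewrite gE /local_fun /=; split=> // n0.
by rewrite xpair_eqE (negbTE n0).
Qed.

Lemma supported_lamps g : g \in [:: gen_a R; gen_b R; gen_u R; gen_v R A] -> supported_at 0 g.
Proof.
rewrite !inE => /or4P[] /eqP ->.
- exact: supported_local.
- exact: supported_local.
- by move=> [[[n m] z] c]; split=> //= n0; rewrite /bump_fun /= (negbTE n0) addr0.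
- by move=> [[[n m] z] c]; split=> //= n0; rewrite /mult_fun /weight /= (negbTE n0) mul1r.
Qed.

(** The shape shared by all elements of the groups: an increasing map of the
    base that permutes copies, and a multiplication by roots of unity along the
    fibres. *)
Definition monomial (g : space -> space) : Prop :=
  exists f : point -> point, exists h : point -> algC, exists tau : int * int -> int * int,
  [/\ forall y c, g (y, c) = (f y, h y * c),
      forall y y', lex_lt y y' -> lex_lt (f y) (f y'),
      forall y, order_in A (h y) &
      forall y, (f y).1 = tau y.1].

Lemma monomial_comp (g g' : space -> space) : monomial g -> monomial g' -> monomial (g \o g').
Proof.
move=> [f [h [tau [gE fl hA ft]]]] [f' [h' [tau' [g'E f'l h'A f't]]]].
exists (f \o f'), (fun y => h (f' y) * h' y), (tau \o tau'); split.
- by move=> y c /=; rewrite g'E gE mulrA.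
- by move=> y y' /f'l /fl.
- by move=> y; apply: order_inM.
- by move=> y /=; rewrite ft f't.
Qed.

Lemma monomial_shift e : monomial (@shift_fun R e).
Proof.
exists (fun y => (y.1.1 + e, y.1.2, y.2)), (fun=> 1), (fun c => (c.1 + e, c.2)); split=> //.
- by move=> y c; rewrite mul1r.
- by move=> [[n m] z] [[n' m'] z']; rewrite /lex_lt /= ltrD2r (inj_eq (addIr e)).
- by move=> _; apply: order_in1.
Qed.

Lemma monomial_bump e : monomial (@bump_fun R e).
Proof.
exists (fun y => (y.1.1, y.1.2 + (if y.1.1 == 0 then e else 0), y.2)), (fun=> 1),
  (fun c => (c.1, c.2 + (if c.1 == 0 then e else 0))); split=> //.
- by move=> y c; rewrite mul1r.
- move=> [[n m] z] [[n' m'] z']; rewrite /lex_lt /=; case: (ltgtP n n') => //= <-.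
  by rewrite ltrD2r (inj_eq (addIr _)).
- by move=> _; apply: order_in1.
Qed.

Lemma monomial_local (h : R -> R) : (forall z z', z < z' -> h z < h z') ->
  monomial (local_fun h).
Proof.
move=> h_lt.
exists (fun y => (y.1, if y.1 == (0, 0) then h y.2 else y.2)), (fun=> 1), id; split=> //.
- by move=> y c; rewrite mul1r.
- move=> [[n m] z] [[n' m'] z']; rewrite /lex_lt /=.
  case: (ltgtP n n') => //= <-; case: (ltgtP m m') => //= <-.
  by case: eqP => // _; apply: h_lt.
- by move=> _; apply: order_in1.
Qed.

Lemma monomial_mult (k : point -> algC) : (forall y, order_in A (k y)) ->
  monomial (mult_fun k).
Proof. by move=> kA; exists id, k, id; split. Qed.

(** Monomiality of the inverse is part of the invariant because generation is
    by group operations. *)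
Definition bimonomial g : Prop := monomial g /\ monomial (g^-1)%g.

Lemma bimonomial_span (x : lamplighter R A) : bimonomial (val x).
Proof.
move: x; apply: span_ind => [|g g' [mg mgV] [mg' mg'V]|g].
- split; exists id, (fun=> 1), id; split=> // *; rewrite ?mul1r//; exact: order_in1.
- split; first exact: (monomial_comp mg mg'V).
  by rewrite invgF; apply: (monomial_comp mg' mgV).
rewrite /= !inE => /or4P[/eqP->|/eqP->|/eqP->|/orP[/eqP->|/eqP->]].
- by split; apply: monomial_local => z z' zz'; rewrite ?/pong_a ?/pong_a' ?ltrD2r;
    [apply: lift_expand_lt|apply: lift_contract_lt; rewrite ltrD2r].
- by split; apply: monomial_local => z z' zz'; rewrite ?/pong_b ?/pong_b' ?ltrD2r;
    [apply: lift_expand_lt; rewrite ltrD2r|apply: lift_contract_lt].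
- by split; apply: monomial_bump.
- split; apply: monomial_mult => y; first exact: order_in_weight.
  exact/order_inV/order_in_weight.
- by split; apply: monomial_shift.
Qed.

(** A nontrivial increasing map moves some point up or down, and then so do its
    powers: the base map of a torsion element is the identity.  Fibrewise, a
    number killed by [p] and by an integer prime to [p] is 1. *)
Lemma torsion_free p g : prime p -> p \notin A -> bimonomial g -> (g ^+ p = 1)%g -> g = 1%g.
Proof.
move=> pp pA [[f [h [tau [gE f_lt hA _]]]] _] gp.
have gX k y c : ((g ^+ k)%g (y, c)).1 = iter k f y.
  rewrite bijX; elim: k => [//|k IH]; rewrite !iterS; case: (iter k g _) IH => [y' c'] /= <-.
  by rewrite gE.
have fid y : f y = y.
  apply: contrapT => /eqP /lex_lt_total fy.
  have p0 := prime_gt0 pp.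
  have iterp : iter p f y = y by rewrite -(gX p y 1) gp.
  have : lex_lt (iter p f y) y \/ lex_lt y (iter p f y).
    case/orP: fy => fy; [left|right].
      case: p p0 {pp pA gp iterp} => // p _; elim: p => [//|p IH].
      rewrite iterS; apply: lex_lt_trans fy; exact: f_lt.
    case: p p0 {pp pA gp iterp} => // p _; elim: p => [//|p IH].
    rewrite iterS; apply: (lex_lt_trans fy); exact: f_lt.
  by rewrite iterp lex_lt_irr => -[].
apply: bij_ext => -[y c]; rewrite gE fid.
have gXh k c' : (g ^+ k)%g (y, c') = (y, h y ^+ k * c').
  rewrite bijX; elim: k => [|k IH]; first by rewrite mul1r.
  by rewrite iterS IH gE fid exprS mulrA.
have [n [n0 hn cn]] := hA y.
suff -> : h y = 1 by rewrite mul1r.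
apply: (@expr_coprime _ _ p n); rewrite ?prime_gt0 ?cn//.
by have := gXh p 1; rewrite gp mulr1 => -[<-].
Qed.

End Properties.

(** * Finite generation, acyclicity and non-amenability *)

Section MainProperties.
Local Open Scope classical_set_scope.
Variables (R : realType) (A : {pred nat}).
Notation space := (space R).
Notation point := (point R).
Notation L := (lamplighter R A).

Definition lamp_gen (i : nat) : L :=
  match i with
  | 0 => span_gen (mem_nth 1%g (isT : 0 < size (gens R A))%N)
  | 1 => span_gen (mem_nth 1%g (isT : 1 < size (gens R A))%N)
  | 2 => span_gen (mem_nth 1%g (isT : 2 < size (gens R A))%N)
  | 3 => span_gen (mem_nth 1%g (isT : 3 < size (gens R A))%N)
  | _ => span_gen (mem_nth 1%g (isT : 4 < size (gens R A))%N)
  end.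

Lemma val_lamp_gen i : (i < 5)%N -> val (lamp_gen i) = nth 1%g (gens R A) i.
Proof. by case: i => [|[|[|[|[|]]]]]. Qed.

(** The five bijections send the origin to five different points. *)
Lemma gens_uniq : uniq (gens R A).
Proof.
pose w : space := ((0, 0, 0), 1).
apply: (@map_uniq _ _ (fun g : bij space => (g w).1)).
have -> : [seq ((g : bij space) w).1 | g : bij space <- gens R A] =
    [:: (0, 0, -1); (0, 0, pong_b 0); (0, 1, 0); (0, 0, 0); (1, 0, 0)].
  by rewrite -(pong_a0 R).
rewrite /= !inE !xpair_eqE !eqxx /= ?andbT ?andbF ?orbF /=.
by rewrite pong_b0; apply/andP; split; [apply/norP; split|]; apply/eqP => ?; lra.
Qed.

Lemma lamplighter_5_generated : n_generated 5 L.
Proof.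
exists (lamp_gen @` `I_5); split.
  apply: inj_card_eq => i j; rewrite !inE => i5 j5 /(congr1 val).
  by rewrite !val_lamp_gen// => /eqP; rewrite nth_uniq ?gens_uniq// => /eqP.
move=> H SH; apply: (span_generates (S := [set g | g \in gens R A])) => x xg.
have i5 : (index (val x) (gens R A) < size (gens R A))%N by rewrite index_mem.
apply: SH; exists (index (val x) (gens R A)); first exact: i5.
by apply: val_inj; rewrite (val_lamp_gen i5) nth_index.
Qed.

Lemma lamplighter_acyclic : boundedly_acyclic R L.
Proof.
pose s (j : 'I_4 * bool) : L := if j.2 then lamp_gen j.1 else (lamp_gen j.1)^-1%g.
have s0 j : supported_at 0 (val (s j)).
  have s1 (i : 'I_4) : supported_at 0 (val (lamp_gen i)).
    apply: (@supported_lamps R A); rewrite val_lamp_gen ?(ltn_trans (ltn_ord i))//.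
    by case: i => [[|[|[|[|]]]]] //= _; rewrite !inE eqxx ?orbT.
  case: j => i []; first exact: s1.
  by rewrite -[s _]/((lamp_gen i)^-1)%g span_valV; apply: supported_atV.
apply: (@acyclic_of_commuting_conjugates R L ('I_4 * bool)%type (lamp_gen 4) s).
- move=> k i j k0; apply: val_inj; rewrite !valM.
  apply: (@supported_at_commute R k%:Z 0) => //; first by case: k k0.
  rewrite span_valV span_valX val_lamp_gen//; exact: supported_at_conj.
- move=> [i b]; exists (i, ~~ b); rewrite /s /=; case: b => //=.
  by rewrite invgK.
- move=> H SH; apply: (span_generates (S := [set g | g \in gens R A])) => x xg.
  apply: SH; have : (index (val x) (gens R A) < size (gens R A))%N by rewrite index_mem.
  have := nth_index 1%g xg; move: (index _ _) => i xi i5.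
  have xE : x = lamp_gen i by apply: val_inj; rewrite (val_lamp_gen i5).
  have : (i = 4 \/ i < 4)%N by move: i5; rewrite /=; lia.
  case=> [i4|i4]; first by left; rewrite xE i4.
  by right; exists (Ordinal i4, true).
- by rewrite card_prod card_ord card_bool.
Qed.

(** The equivariant map to the line.  It follows which point is brought to copy
    0 of level 0 from the origin of its copy; multiplying [g] on the left by a
    homeomorphism [h] of that copy does not change which copy arrives there. *)
Definition height (g : bij space) : R :=
  (g (((g^-1)%g ((0, 0, 0), 1)).1.1, 0, 1)).1.2.

Lemma height_local g (h h' : R -> R) (hK : cancel h h') (h'K : cancel h' h) :
  bimonomial A g -> height (Bij (local_funK hK) (local_funK h'K) * g)%g = h (height g).
Proof.
move=> [[f [k [tau [gE _ _ ft]]]] [f' [k' [tau' [g'E _ _ f't]]]]].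
rewrite /height invgM !bijM.
set a := Bij _ _.
have -> : (a^-1)%g (0, 0, 0, 1) = (0, 0, h' 0, 1) by [].
rewrite !g'E /= !f't /=.
set c := tau' (0, 0).
have c0 : tau c = (0, 0).
  have : (g ((g^-1)%g (0, 0, 0, 1))).1.1 = (0, 0) by rewrite bijVK.
  by rewrite g'E gE /= ft f't.
by rewrite gE /= /local_fun /= ft c0 eqxx.
Qed.

(** The preimages under [height] of the four quarters of the circle are disjoint;
    [a] maps the complement of the first into the third, and [b] that of the
    second into the fourth.  An invariant mean would give them total mass at
    least 2. *)
Lemma lamplighter_nonamenable : ~ amenable R L.
Proof.
case=> mu [mu0 muT muU muI].
have mu_mono X Y : X `<=` Y -> mu X <= mu Y.
  move=> XY; have -> : Y = X `|` (Y `\` X) by rewrite setDUK.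
  by rewrite muU ?lerDl// setDIK.
have muC X : mu (~` X) = 1 - mu X.
  have : mu (X `|` ~` X) = mu X + mu (~` X) by rewrite muU// setICr.
  by rewrite setUCr muT => ->; rewrite addrC addKr.
pose E i : set L := [set x | arc i (height (val x))].
have step (x0 : L) (h : R -> R) i j :
    (forall x : L, height (val (x0 * x)%g) = h (height (val x))) ->
    (forall z, ~ arc i z -> arc j (h z)) -> 1 <= mu (E i) + mu (E j).
  move=> x0h hij; rewrite -lerBlDl -muC -(muI x0); apply: mu_mono.
  by move=> _ [x /= nx <-]; rewrite /E /= x0h; apply: hij.
have ha : 1 <= mu (E 0%N) + mu (E 2%N).
  apply: (step (lamp_gen 0) (@pong_a R)) => [x|]; last exact: pong_a_arc.
  exact: (height_local _ _ (bimonomial_span x)).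
have hb : 1 <= mu (E 1%N) + mu (E 3%N).
  apply: (step (lamp_gen 1) (@pong_b R)) => [x|]; last exact: pong_b_arc.
  exact: (height_local _ _ (bimonomial_span x)).
have disj i j : i != j -> E i `&` E j = set0.
  move=> ij; apply/seteqP; split=> // x [/= xi xj].
  by move/eqP: ij; apply; apply: arc_disj xi xj.
have U2 X Y Z : X `&` Z = set0 -> Y `&` Z = set0 -> (X `|` Y) `&` Z = set0.
  by move=> e e'; rewrite setIUl e e' setU0.
have : mu (E 0%N `|` E 2%N `|` E 1%N `|` E 3%N) <= 1 by rewrite -muT; apply: mu_mono.
rewrite !muU; [lra|..].
- exact: disj.
- by apply: (U2); apply: disj.
- by apply: (U2); [apply: (U2)|]; apply: disj.
Qed.

End MainProperties.

(** * Torsion as an invariant and the continuum of groups *)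

Definition has_torsion (G : groupType) (n : nat) : Prop :=
  exists x : G, x <> 1%g /\ (x ^+ n = 1)%g.

Section Torsion.
Variables (R : realType) (A : {pred nat}).
Notation space := (space R).
Notation point := (point R).
Notation L := (lamplighter R A).

Lemma lamplighter_torsion_free p (x : L) :
  prime p -> p \notin A -> (x ^+ p = 1)%g -> x = 1%g.
Proof.
move=> pp pA xp; apply: val_inj; rewrite val1.
apply: (torsion_free pp pA (bimonomial_span x)).
by rewrite -span_valX xp val1.
Qed.

(** Powers of [u] bring the support of [a] to any copy of level 0. *)
Lemma gen_uX k (w : space) : (gen_u R ^+ k)%g w = bump_fun k%:Z w.
Proof.
rewrite bijX; elim: k w => [|k IH] [[[n m] z] c] /=; rewrite ?IH /bump_fun /=.
  by case: eqP; rewrite addr0.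
by case: eqP; rewrite ?addr0// -addrA -[k.+1]addn1 PoszD.
Qed.

Lemma weightX p (y : point) : y.1 = (0, Posz p) -> weight A y ^+ p = 1.
Proof.
case: y => [nm z] /= ->; rewrite /weight /=; case: eqP => _; last exact: expr1n.
case: ifP => [/andP[pp _]|]; last by rewrite expr1n.
exact/prim_expr_order/unity_rootP/prime_gt0.
Qed.

(** The witness is the commutator of [v] with the conjugate of [a] by [u ^+ p].
    As this conjugate fixes all copies but one, the commutator multiplies by 1
    except over copy [p], where roots of unity of order [p] remain. *)
Lemma lamplighter_torsion p : prime p -> p \in A -> has_torsion L p.
Proof.
move=> pp pA.
(* In the order of the list of generators: 0 is a, 2 is u and 3 is v. *)
pose w : L := (lamp_gen R A 2 ^+ p * lamp_gen R A 0 * lamp_gen R A 2 ^- p)%g.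
pose g (y : point) : point := (y.1, if y.1 == (0, Posz p) then pong_a' y.2 else y.2).
have wV y c : (val w)^-1%g (y, c) = (g y, c).
  have vu : val (lamp_gen R A 2) = gen_u R by [].
  have va : val (lamp_gen R A 0) = gen_a R by [].
  rewrite /w !valM span_valV span_valX vu va !invgM invgK !bijM.
  have := bijVK (gen_u R ^+ p)%g (y, c).
  case: ((gen_u R ^- p)%g (y, c)) => -[[n m] z] c'.
  rewrite !gen_uX /bump_fun /g /= => -[<- <-] /=.
  rewrite /local_fun /= !xpair_eqE; case: (eqVneq n 0) => [->|n0]; congr (_, _, _, _) => //=.
  by rewrite -{2}[Posz p]add0r (inj_eq (addIr _)).
have wE y c : val w (g y, c) = (y, c) by rewrite -wV bijVK.
clearbody w.
pose v := lamp_gen R A 3.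
pose x : L := (v * (w * (v^-1 * w^-1)))%g.
pose k y := weight A y * (weight A (g y))^-1.
have xE y c : val x (y, c) = (y, k y * c).
  rewrite /x !valM !span_valV !bijM wV.
  have -> c' : (val v)^-1%g (g y, c') = (g y, (weight A (g y))^-1 * c') by [].
  by rewrite wE -[RHS]/(y, k y * c) /k -mulrA.
have xX n y c : (val x ^+ n)%g (y, c) = (y, k y ^+ n * c).
  rewrite bijX; elim: n => [|n IH]; first by rewrite mul1r.
  by rewrite iterS IH xE exprS mulrA.
exists x; split.
  move/(congr1 val) => x1; have := xE (0, Posz p, 0) 1; rewrite x1 val1 /= => -[].
  rewrite mulr1 /k /weight /g /= !eqxx pp pA /=.
  case: eqP => [a0|_].
    have := pong_a'K (0 : R); rewrite a0 pong_a0 => /eqP.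
    by rewrite oppr_eq0 oner_eq0.
  rewrite invr1 mulr1 => e1; have := prim_order_dvd (unity_rootP (prime_gt0 pp)) 1.
  by rewrite expr1 e1 eqxx dvdn1 => /eqP p1; rewrite p1 in pp.
apply: val_inj; rewrite span_valX val1; apply: bij_ext => -[y c].
rewrite xX /k; case: (eqVneq y.1 (0, Posz p)) => yp.
  by rewrite exprMn exprVn !weightX// invr1 !mul1r.
have -> : g y = y by rewrite /g (negbTE yp); case: (y).
by rewrite divff ?weight_neq0// expr1n mul1r.
Qed.

End Torsion.

Lemma torsion_isomorphic (G H : groupType) (n : nat) :
  isomorphic G H -> has_torsion G n <-> has_torsion H n.
Proof.
move=> [f [f' fK f'K]].
have f1 : f 1%g = 1%g by apply: (@mulgI _ (f 1%g)); rewrite -gmulfM !mulg1.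
have fX x : f (x ^+ n)%g = (f x ^+ n)%g.
  by elim: n => [//|m IH]; rewrite !expgS gmulfM IH.
split=> -[x [x1 xn]].
  exists (f x); split; last by rewrite -fX xn.
  by rewrite -f1 => /(can_inj fK).
exists (f' x); split; last by apply: (can_inj fK); rewrite fX f'K xn f1.
by move=> fx1; apply: x1; rewrite -[x]f'K fx1.
Qed.

(** An injective sequence of primes, not the sequence of all primes. *)
Fixpoint nth_prime (n : nat) : nat :=
  if n is m.+1 then s2val (prime_above (nth_prime m)) else 2%N.

Lemma nth_prime_prime n : prime (nth_prime n).
Proof. by case: n => [//|n] /=; case: prime_above. Qed.

Lemma nth_prime_inj : injective nth_prime.
Proof.
have lt m n : (m < n)%N -> (nth_prime m < nth_prime n)%N.
  apply: (@homo_ltn _ nth_prime (fun a b => a < b)%N ltn_trans) => i /=; by case: prime_above.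
by move=> m n e; case: (ltngtP m n) => // /lt; rewrite e ltnn.
Qed.

(** A Dedekind cut, written in primes instead of rational numbers. *)
Definition cut_primes (R : realType) (t : R) : {pred nat} :=
  [pred p | `[< exists2 r : rat, ratr r < t & p = nth_prime (pickle r) >]].

Lemma cut_primes_separate (R : realType) (s t : R) : s < t ->
  exists p, [/\ prime p, p \in cut_primes t & p \notin cut_primes s].
Proof.
move=> /rat_in_itvoo[r]; rewrite in_itv /= => /andP[sr rt].
exists (nth_prime (pickle r)); split; first exact: nth_prime_prime.
  by apply/asboolP; exists r.
apply/negP => /asboolP[r' r's /nth_prime_inj /(pcan_inj pickleK) e].
by move: r's; rewrite -e ltNge (ltW sr).
Qed.

(** Between two reals lies a rational number, whose prime is the order of an
    element in exactly one of the two groups. *)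
Theorem corollary3 (R : realType) :
  exists G : R -> groupType,
    (forall t : R,
       [/\ n_generated 5 (G t), ~ amenable R (G t) & boundedly_acyclic R (G t)]) /\
    (forall s t : R, s <> t -> ~ isomorphic (G s) (G t)).
Proof.
exists (fun t => lamplighter R (cut_primes t)); split.
  move=> t; split; [exact: lamplighter_5_generated | exact: lamplighter_nonamenable |].
  exact: lamplighter_acyclic.
move=> s t /eqP; rewrite neq_lt => /orP[] /cut_primes_separate[p [pp pin pnotin]].
all: move=> /(torsion_isomorphic p) st.
  have /st[x [x1 xp]] := lamplighter_torsion R pp pin.
  exact/x1/(lamplighter_torsion_free pp pnotin).
have /st[x [x1 xp]] := lamplighter_torsion R pp pin.
exact/x1/(lamplighter_torsion_free pp pnotin).
Qed.
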